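(* Assume (A1), (A2) and (A3) (listed in the context). Problem (PO-CMF) is equivalent to problem (FO-CMF); that is, a control $u^*\in\mathcal U_{ad}$ satisfies $J^P(\xi,\ell_0;u^* )=\inf_{v\in\mathcal U_{ad}}J^P(\xi,\ell_0;v)$ if and only if it satisfies $J^F(\xi,\ell_0;u^* )=\inf_{v\in\mathcal U_{ad}}J^F(\xi,\ell_0;v)$.
   Context: Probability space. Fix $T>0$ and positive integers $n,m,r,d,D$. $(\Omega,\mathcal F,\mathbb F,\mathbb P)$ is a complete filtered probability space satisfying the usual conditions and supporting mutually independent objects: standard Brownian motions $W$ (in $\mathbb R^r$) and $\bar W$ (in $\mathbb R^d$); a time-homogeneous continuous-time Markov chain $\theta=\{\theta_t\}_{t\in[0,T]}$ with state space $\mathbb D=\{1,\dots,D\}$ and $\theta_0=\ell_0$; and a Gaussian random vector $\xi\in\mathbb R^n$ with mean $\mu$ and covariance matrix $\sigma$. $\mathcal F_t=\sigma\{\xi,W_s,\bar W_s,\theta_s;s\in[0,t]\}$, $\mathbb F=\{\mathcal F_t\}$. For a process (or list of processes) $\beta$, $\mathcal F^\beta_t$ is the information generated by $\beta$ up to time $t$, $\mathbb F^\beta=\{\mathcal F^\beta_t\}$, and $\mathbb E^\beta_t[\cdot]=\mathbb E[\cdot|\mathcal F^\beta_t]$. State and observation. For an $\mathbb R^m$-valued control $v$, $$dX^v_t=\big[A_{(\theta_t,t)}X^v_t+\widehat A_{(\theta_t,t)}\mathbb E^\theta_t[X^v_t]+B_{(\theta_t,t)}v_t+\widehat B_{(\theta_t,t)}\mathbb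 E^\theta_t[v_t]+b_{(\theta_t,t)}\big]dt+C_{(\theta_t,t)}dW_t+\bar C_{(\theta_t,t)}d\bar W_t,\quad X^v_0=\xi,$$ $$dY^v_t=\big[F_{(\theta_t,t)}X^v_t+\widehat F_{(\theta_t,t)}\mathbb E^\theta_t[X^v_t]+f_{(\theta_t,t)}\big]dt+dW_t,\quad Y^v_0=0\in\mathbb R^r.$$ Admissible controls. Let $\eta$ solve $d\eta_t=[A_{(\theta_t,t)}\eta_t+\widehat A_{(\theta_t,t)}\mathbb E^\theta_t[\eta_t]+b_{(\theta_t,t)}]dt+C_{(\theta_t,t)}dW_t+\bar C_{(\theta_t,t)}d\bar W_t$, $\eta_0=\xi$, and $d\lambda_t=[F_{(\theta_t,t)}\eta_t+\widehat F_{(\theta_t,t)}\mathbb E^\theta_t[\eta_t]+f_{(\theta_t,t)}]dt+dW_t$, $\lambda_0=0$. $\mathcal U$ is the set of $\mathbb R^m$-valued $\mathbb F^{\lambda,\theta}$-adapted processes $v$ with $\mathbb E[\sup_{t\in[0,T]}|v_t|^2]<\infty$, and $\mathcal U_{ad}$ is the set of $v\in\mathcal U$ that are also $\mathbb F^{Y^v,\theta}$-adapted. Costs. For a square-integrable $\mathbb R^n$-valued process $Z$ put $$\mathcal J(Z,v)=\tfrac12\mathbb E\Big\{\int_0^T\Big[\langle Z,HZ\rangle+2\langle v,GZ\rangle+\langle v,Rv\rangle+\langle\mathbb E^\theta_t[Z],\widehat H\mathbb E^\theta_t[Z]\rangle+2\langle\mathbb E^\theta_t[v],\widehat G\mathbb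 E^\theta_t[Z]\rangle+\langle\mathbb E^\theta_t[v],\widehat R\mathbb E^\theta_t[v]\rangle\Big]dt+\langle Z_T,S_{\theta_T}Z_T\rangle+\langle\mathbb E^\theta_T[Z_T],\widehat S_{\theta_T}\mathbb E^\theta_T[Z_T]\rangle\Big\},$$ weights in the integral evaluated at $(\theta_t,t)$ and processes at $t$. Then $J^P(\xi,\ell_0;v)=\mathcal J(X^v,v)$ and $J^F(\xi,\ell_0;v)=\mathcal J(\mathbb X^v,v)$, where $\mathbb X^v_t=\mathbb E^{Y^v,\theta}_t[X^v_t]$ is the filter of the state; it satisfies $$d\mathbb X^v_t=\big[A_{(\theta_t,t)}\mathbb X^v_t+\widehat A_{(\theta_t,t)}\mathbb E^\theta_t[\mathbb X^v_t]+B_{(\theta_t,t)}v_t+\widehat B_{(\theta_t,t)}\mathbb E^\theta_t[v_t]+b_{(\theta_t,t)}\big]dt+Q_tdV_t,\quad\mathbb X^v_0=\mu,$$ with $V_t=Y^v_t-\int_0^t[F_{(\theta_s,s)}\mathbb X^v_s+\widehat F_{(\theta_s,s)}\mathbb E^\theta_s[X^v_s]+f_{(\theta_s,s)}]ds$, $Q_t=C_{(\theta_t,t)}+\Phi_tF_{(\theta_t,t)}^\top$, $\Phi_t=\mathbb E^{Y^v,\theta}_t[(X^v_t-\mathbb X^v_t)(X^v_t-\mathbb X^v_t)^\top]$. (PO-CMF): find $u^*\in\mathcal U_{ad}$ minimizing $J^P(\xi,\ell_0;\cdot)$ over $\mathcal U_{ad}$ subject to the equations of $X^v,Y^v$. (FO-CMF):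 find $u^*\in\mathcal U_{ad}$ minimizing $J^F(\xi,\ell_0;\cdot)$ over $\mathcal U_{ad}$ subject to the equation of $\mathbb X^v$. Notation: $\check\psi=\psi+\widehat\psi$ for $\psi=A,B,H,G,R,S$. Assumptions. (A1) For each $\ell\in\mathbb D$, $A_{(\ell,t)},\widehat A_{(\ell,t)}\in\mathbb R^{n\times n}$, $B_{(\ell,t)},\widehat B_{(\ell,t)}\in\mathbb R^{n\times m}$, $C_{(\ell,t)}\in\mathbb R^{n\times r}$, $\bar C_{(\ell,t)}\in\mathbb R^{n\times d}$, $F_{(\ell,t)},\widehat F_{(\ell,t)}\in\mathbb R^{r\times n}$, $b_{(\ell,t)}\in\mathbb R^n$, $f_{(\ell,t)}\in\mathbb R^r$ are deterministic bounded (Borel measurable) functions on $[0,T]$. (A2) For each $\ell$, $H_{(\ell,t)},\widehat H_{(\ell,t)}\in\mathbb S^n$, $G_{(\ell,t)},\widehat G_{(\ell,t)}\in\mathbb R^{m\times n}$, $R_{(\ell,t)},\widehat R_{(\ell,t)}\in\mathbb S^m$ are deterministic bounded (Borel measurable) functions on $[0,T]$ and $S_\ell,\widehat S_\ell\in\mathbb S^n$ are deterministic matrices ($\mathbb S^k$: symmetric $k\times k$ real matrices). (A3) There is a constant $\delta>0$ such that for all $\ell\in\mathbb D$, $t\in[0,T]$: $R_{(\ell,t)}\ge\delta I$, $\check R_{(\ell,t)}\geq\delta I$, $H_{(\ell,t)}-G_{(\ell,t)}^\top R_{(\ell,t)}^{-1}G_{(\ell,t)}\ge0$, $\check H_{(\ell,t)}-\check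 G_{(\ell,t)}^\top\check R_{(\ell,t)}^{-1}\check G_{(\ell,t)}\ge0$, $S_\ell\ge0$, $\check S_\ell\ge0$. *)

(* Defs.v *)
From HB Require Import structures.
From mathcomp Require Import all_boot all_order all_algebra.
From mathcomp Require Import all_classical all_reals all_analysis.
Import Order.TTheory GRing.Theory Num.Theory.
Import numFieldNormedType.Exports.

Set Implicit Arguments.
Unset Strict Implicit.
Unset Printing Implicit Defensive.

Local Open Scope classical_set_scope.
Local Open Scope ring_scope.

(** Vectors and matrices *)

Section linear_algebra.
Context {R : realType}.

Definition inner {k : nat} (u v : 'cV[R]_k) : R := \sum_i u i 0 * v i 0.

(* squared Euclidean (Frobenius) norm *)
Definition sqnorm {p k : nat} (M : 'M[R]_(p, k)) : R := \sum_i \sum_j M i j ^+ 2.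

Definition psd {k : nat} (M : 'M[R]_k) : Prop :=
  forall x : 'cV[R]_k, 0 <= inner x (M *m x).

Definition symmetric {k : nat} (M : 'M[R]_k) : Prop := M^T = M.

(* componentwise integral over [0, t] *)
Definition vint {k : nat} (t : R) (f : R -> 'cV[R]_k) : 'cV[R]_k :=
  \col_i (\int[@lebesgue_measure R]_(s in `[0, t]) f s i 0).

Definition bounded_borel (T : R) {D p k : nat} (M : 'I_D -> R -> 'M[R]_(p, k)) :
    Prop :=
  (forall l i j, measurable_fun `[0, T] (fun t => M l t i j)) /\
  exists K : R, forall l t i j, t \in `[0, T] -> `|M l t i j| <= K.

(* N(m, v); [normal_prob m s] takes the standard deviation and is not the Dirac
   mass when [s = 0], whence the case distinction. *)
Definition gaussian_law (m v : R) (B : set R) : \bar R :=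
  if v == 0 then dirac m B else normal_prob m (Num.sqrt v) B.

End linear_algebra.

(** Processes, sigma-algebras, conditional expectations *)

Notation process O R k := (R -> O -> 'cV[R]_k) (only parsing).

Section processes.
Context {R : realType} {dO : measure_display} {O : measurableType dO}.
Variables (P : probability O R) (T : R).

Local Notation mu := (@lebesgue_measure R).

(* generators of the sigma-algebra of a random vector, of (Z_s)_{s <= t},
   and of (theta_s)_{s <= t} *)
Definition events_rv {k : nat} (Z : O -> 'cV[R]_k) : set (set O) :=
  [set A | exists i (B : set R),
    measurable B /\ A = (fun w => Z w i 0) @^-1` B].

Definition events_upto {k : nat} (Z : process O R k) (t : R) : set (set O) :=
  \bigcup_(s in `[0, t]) events_rv (Z s).

Definition events_chain {D : nat} (theta : R -> O -> 'I_D) (t : R) :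
    set (set O) :=
  [set A | exists s l, s \in `[0, t] /\ A = [set w | theta s w = l]].

(* sigma-algebra generated by G and the null sets *)
Definition augmented (G : set (set O)) : set (set O) :=
  <<s G `|` P.-negligible >>.

(* (t, w) |-> Z t w is measurable on [0, T] x O *)
Definition measurable_process {k : nat} (Z : process O R k) : Prop :=
  forall i, measurable_fun (`[0, T] `*` [set: O])
    (fun z : measurableTypeR R * O => Z z.1 z.2 i 0).

Definition adapted (F : R -> set (set O)) {k : nat} (Z : process O R k) : Prop :=
  forall t, t \in `[0, T] -> events_rv (Z t) `<=` F t.

(* E [sup_{t in [0, T]} |Z_t|^2] < oo *)
Definition sup_square_integrable {k : nat} (Z : process O R k) : Prop :=
  (\int[P]_w ereal_sup [set (sqnorm (Z t w))%:E | t in `[0%R, T]] < +oo)%E.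

(* Z' = E[Z | G] *)
Definition is_cond_exp (G : set (set O)) (Z Z' : O -> R) : Prop :=
  [/\ P.-integrable setT (EFin \o Z),
      P.-integrable setT (EFin \o Z'),
      (forall B : set R, measurable B -> G (Z' @^-1` B)) &
      forall A, G A ->
        (\int[P]_(w in A) (Z' w)%:E = \int[P]_(w in A) (Z w)%:E)%E].

(* Z' is a jointly measurable version of t |-> E[Z_t | F_t] *)
Definition is_cond_process (F : R -> set (set O)) {k : nat}
    (Z Z' : process O R k) : Prop :=
  measurable_process Z' /\
  forall t i, t \in `[0, T] ->
    is_cond_exp (F t) (fun w => Z t w i 0) (fun w => Z' t w i 0).

Definition has_cond_process (F : R -> set (set O)) {k : nat}
    (Z : process O R k) : Prop :=
  exists Z', is_cond_process F Z Z'.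

(* the process t |-> E[Z_t | F_t]; versions differ only by modification, which
   changes neither the state equation nor the cost *)
Definition cond_process (F : R -> set (set O)) {k : nat}
    (Z : process O R k) : process O R k :=
  xget (fun _ _ => 0) [set Z' | is_cond_process F Z Z'].

Definition usual_conditions (F : R -> set (set O)) : Prop :=
  [/\ measure_is_complete P,
      P.-negligible `<=` F 0 &
      forall t, 0 <= t < T -> \bigcap_(s in `]t, T]) F s `<=` F t].

Definition independent2 (G1 G2 : set (set O)) : Prop :=
  forall A1 A2, G1 A1 -> G2 A2 -> (P (A1 `&` A2) = P A1 * P A2)%E.

(* the A_i may be the whole space, so this covers the subfamilies as well *)
Definition independent4 (G1 G2 G3 G4 : set (set O)) : Prop :=
  forall A1 A2 A3 A4, G1 A1 -> G2 A2 -> G3 A3 -> G4 A4 ->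
    (P (A1 `&` A2 `&` A3 `&` A4) = P A1 * P A2 * P A3 * P A4)%E.

(* Gaussian vectors: every linear functional is Gaussian *)
Definition gaussian_vector {k : nat} (Z : O -> 'cV[R]_k) (m : 'cV[R]_k)
    (sigma : 'M[R]_k) : Prop :=
  [/\ symmetric sigma, psd sigma,
      (forall i, measurable_fun setT (fun w => Z w i 0)) &
      forall (u : 'cV[R]_k) (B : set R), measurable B ->
        P ((fun w => inner u (Z w)) @^-1` B) =
        gaussian_law (inner u m) (inner u (sigma *m u)) B].

Definition continuous_paths {k : nat} (Z : process O R k) : Prop :=
  forall w i, {within `[0, T], continuous (fun t => Z t w i 0)}.

Record brownian_motion {k : nat} (W : process O R k) : Prop := {
  bm_measurable : forall t i, t \in `[0, T] ->
    measurable_fun setT (fun w => W t w i 0) ;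
  bm_zero : {ae P, forall w, W 0 w = 0} ;
  bm_continuous : continuous_paths W ;
  bm_gaussian : forall s t, 0 <= s -> s <= t -> t <= T ->
    gaussian_vector (fun w => W t w - W s w) 0 ((t - s)%:M) ;
  bm_independent : forall s t, 0 <= s -> s <= t -> t <= T ->
    independent2 <<s events_upto W s >>
                 <<s events_rv (fun w => W t w - W s w) >> }.

(* standard transition function of a time-homogeneous chain on 'I_D *)
Record transition_function {D : nat} (p : R -> 'M[R]_D) : Prop := {
  tf_ge0 : forall t i j, 0 <= t -> 0 <= p t i j ;
  tf_sum1 : forall t i, 0 <= t -> \sum_j p t i j = 1 ;
  tf_0 : p 0 = 1%:M ;
  tf_semigroup : forall s t, 0 <= s -> 0 <= t -> p (s + t) = p s *m p t ;
  tf_standard : forall i j, p t i j @[t --> 0^'+] --> ((i == j)%:R : R) }.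

(* [mc_markov] is P(theta_t = j | theta_u, u <= s) = p_{t-s}(theta_s, j),
   integrated over the events A of the past *)
Record markov_chain {D : nat} (l0 : 'I_D) (theta : R -> O -> 'I_D) : Prop := {
  mc_measurable : forall t l, t \in `[0, T] ->
    measurable [set w | theta t w = l] ;
  mc_zero : {ae P, forall w, theta 0 w = l0} ;
  mc_right : forall w t, 0 <= t < T ->
    exists2 e, 0 < e & forall s, t <= s < t + e -> theta s w = theta t w ;
  mc_left : forall w t, 0 < t <= T ->
    exists l, exists2 e, 0 < e &
      forall s, t - e < s < t -> 0 <= s -> theta s w = l ;
  mc_markov : exists2 p : R -> 'M[R]_D, transition_function p &
    forall s t j A, 0 <= s -> s <= t -> t <= T ->
      <<s events_chain theta s >> A ->
      P (A `&` [set w | theta t w = j]) =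
      (\sum_i (p (t - s) i j)%:E * P (A `&` [set w | theta s w = i]))%E }.

(** Ito integral of a matrix process against a Brownian motion, as the L^2 limit
    of the integrals of simple processes *)

(* sum_{i < sp_n} sp_c i 1_(sp_t i, sp_t (i+1)] *)
Record simple_process (p k : nat) := SimpleProcess {
  sp_n : nat ;
  sp_t : nat -> R ;
  sp_c : nat -> O -> 'M[R]_(p, k) }.

Definition simple_adapted (F : R -> set (set O)) {p k : nat}
    (S : simple_process p k) : Prop :=
  [/\ (forall i, (i <= sp_n S)%N -> sp_t S i \in `[0, T]),
      (forall i, (i < sp_n S)%N -> sp_t S i <= sp_t S i.+1),
      (forall i a b (B : set R), (i < sp_n S)%N -> measurable B ->
        F (sp_t S i) ((fun w => sp_c S i w a b) @^-1` B)) &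
      exists K : R, forall i w a b, (i < sp_n S)%N -> `|sp_c S i w a b| <= K].

Definition simple_eval {p k : nat} (S : simple_process p k) (t : R) (w : O) :
    'M[R]_(p, k) :=
  \sum_(i < sp_n S) (if sp_t S i < t <= sp_t S i.+1 then sp_c S i w else 0).

Definition simple_int {p k : nat} (S : simple_process p k) (W : process O R k) :
    process O R p :=
  fun t w => \sum_(i < sp_n S)
    sp_c S i w *m (W (Num.min (sp_t S i.+1) t) w - W (Num.min (sp_t S i) t) w).

(* I_t = int_0^t phi_s dW_s on [0, T] *)
Definition is_ito_integral (F : R -> set (set O)) {p k : nat}
    (W : process O R k) (phi : R -> O -> 'M[R]_(p, k)) (I : process O R p) :
    Prop :=
  [/\ continuous_paths I,
      adapted F I &
      exists S : nat -> simple_process p k,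
        [/\ (forall j, simple_adapted F (S j)),
            (\int[P]_w \int[mu]_(t in `[0%R, T])
               (sqnorm (simple_eval (S j) t w - phi t w))%:E)%E
              @[j --> \oo] --> 0%E &
            forall t, t \in `[0, T] ->
              (\int[P]_w (sqnorm (I t w - simple_int (S j) W t w))%:E)%E
                @[j --> \oo] --> 0%E]].

End processes.

(** The control problem. A suffix [h] stands for a hat, [b] for a bar. *)

Record coefficients (R : realType) (n m r d D : nat) := Coefficients {
  cA  : 'I_D -> R -> 'M[R]_n ;
  cAh : 'I_D -> R -> 'M[R]_n ;
  cB  : 'I_D -> R -> 'M[R]_(n, m) ;
  cBh : 'I_D -> R -> 'M[R]_(n, m) ;
  cb  : 'I_D -> R -> 'cV[R]_n ;
  cC  : 'I_D -> R -> 'M[R]_(n, r) ;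
  cCb : 'I_D -> R -> 'M[R]_(n, d) ;
  cF  : 'I_D -> R -> 'M[R]_(r, n) ;
  cFh : 'I_D -> R -> 'M[R]_(r, n) ;
  cf  : 'I_D -> R -> 'cV[R]_r }.

Record weights (R : realType) (n m D : nat) := Weights {
  wH  : 'I_D -> R -> 'M[R]_n ;
  wHh : 'I_D -> R -> 'M[R]_n ;
  wG  : 'I_D -> R -> 'M[R]_(m, n) ;
  wGh : 'I_D -> R -> 'M[R]_(m, n) ;
  wR  : 'I_D -> R -> 'M[R]_m ;
  wRh : 'I_D -> R -> 'M[R]_m ;
  wS  : 'I_D -> 'M[R]_n ;
  wSh : 'I_D -> 'M[R]_n }.

Record noise (R : realType) (O : Type) (n r d D : nat) := Noise {
  nW     : process O R r ;
  nWb    : process O R d ;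
  ntheta : R -> O -> 'I_D ;
  nxi    : O -> 'cV[R]_n }.

Section assumptions.
Context {R : realType} {n m r d D : nat}.
Variable T : R.

Definition assumption_A1 (c : coefficients R n m r d D) : Prop :=
  [/\ bounded_borel T (cA c) /\ bounded_borel T (cAh c),
      bounded_borel T (cB c) /\ bounded_borel T (cBh c),
      bounded_borel T (cC c) /\ bounded_borel T (cCb c),
      bounded_borel T (cF c) /\ bounded_borel T (cFh c) &
      bounded_borel T (cb c) /\ bounded_borel T (cf c)].

Definition assumption_A2 (q : weights R n m D) : Prop :=
  [/\ bounded_borel T (wH q) /\ bounded_borel T (wHh q),
      bounded_borel T (wG q) /\ bounded_borel T (wGh q),
      bounded_borel T (wR q) /\ bounded_borel T (wRh q),
      (forall l t, t \in `[0, T] ->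
        [/\ symmetric (wH q l t), symmetric (wHh q l t),
            symmetric (wR q l t) & symmetric (wRh q l t)]) &
      forall l, symmetric (wS q l) /\ symmetric (wSh q l)].

Definition assumption_A3 (q : weights R n m D) : Prop :=
  exists2 delta : R, 0 < delta &
    forall l t, t \in `[0, T] ->
      let H := wH q l t in let Hc := H + wHh q l t in
      let G := wG q l t in let Gc := G + wGh q l t in
      let Rw := wR q l t in let Rc := Rw + wRh q l t in
      [/\ psd (Rw - delta%:M) /\ psd (Rc - delta%:M),
          psd (H - G^T *m invmx Rw *m G),
          psd (Hc - Gc^T *m invmx Rc *m Gc) &
          psd (wS q l) /\ psd (wS q l + wSh q l)].

End assumptions.

Section control_problem.
Context {R : realType} {dO : measure_display} {O : measurableType dO}.
Variables (P : probability O R) (T : R).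
Context {n m r d D : nat}.
Variables (c : coefficients R n m r d D) (q : weights R n m D)
  (N : noise R O n r d D).

Local Notation mu := (@lebesgue_measure R).
Local Notation theta := (ntheta N).

(* (F_t), (F^theta_t), and (F^{Z,theta}_t), all augmented by the null sets *)
Definition full_filtration (t : R) : set (set O) :=
  augmented P (events_rv (nxi N) `|` events_upto (nW N) t
    `|` events_upto (nWb N) t `|` events_chain theta t).

Definition chain_filtration (t : R) : set (set O) :=
  augmented P (events_chain theta t).

Definition joint_filtration {k : nat} (Z : process O R k) (t : R) :
    set (set O) :=
  augmented P (events_upto Z t `|` events_chain theta t).

Record noise_assumptions (l0 : 'I_D) (mean : 'cV[R]_n) (sigma : 'M[R]_n) :
    Prop := {
  noise_usual : usual_conditions P T full_filtration ;
  noise_W : brownian_motion P T (nW N) ;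
  noise_Wb : brownian_motion P T (nWb N) ;
  noise_theta : markov_chain P T l0 theta ;
  noise_xi : gaussian_vector P (nxi N) mean sigma ;
  noise_independent :
    independent4 P <<s events_upto (nW N) T >> <<s events_upto (nWb N) T >>
      <<s events_chain theta T >> <<s events_rv (nxi N) >> }.

(* E^theta_t[Z_t] *)
Definition Etheta {k : nat} (Z : process O R k) : process O R k :=
  cond_process P T chain_filtration Z.

(* Z solves the state equation with control terms [g]; [IW] and [IWb] are the
   stochastic integrals of C against W and of Cbar against Wbar *)
Definition linear_sde (IW IWb : process O R n) (g : process O R n)
    (Z : process O R n) : Prop :=
  [/\ measurable_process T Z,
      adapted T full_filtration Z,
      sup_square_integrable P T Z,
      has_cond_process P T chain_filtration Z &
      {ae P, forall w, forall t, t \in `[0, T] ->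
        Z t w = nxi N w
          + vint t (fun s => cA c (theta s w) s *m Z s w
                           + cAh c (theta s w) s *m Etheta Z s w
                           + g s w + cb c (theta s w) s)
          + IW t w + IWb t w}].

Definition is_state (IW IWb : process O R n) (v : process O R m)
    (X : process O R n) : Prop :=
  has_cond_process P T chain_filtration v /\
  linear_sde IW IWb
    (fun s w => cB c (theta s w) s *m v s w
              + cBh c (theta s w) s *m Etheta v s w) X.

Definition is_uncontrolled_state (IW IWb : process O R n)
    (eta : process O R n) : Prop :=
  linear_sde IW IWb (fun _ _ => 0) eta.

(* Y is the observation of the state process Z *)
Definition is_observation (Z : process O R n) (Y : process O R r) : Prop :=
  [/\ measurable_process T Y,
      adapted T full_filtration Y &
      {ae P, forall w, forall t, t \in `[0, T] ->
        Y t w = vint t (fun s => cF c (theta s w) s *m Z s w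
                               + cFh c (theta s w) s *m Etheta Z s w
                               + cf c (theta s w) s)
          + nW N t w}].

Definition controls (lambda : process O R r) : set (process O R m) :=
  [set v | [/\ measurable_process T v,
               adapted T (joint_filtration lambda) v &
               sup_square_integrable P T v]].

Definition admissible_controls (lambda : process O R r)
    (Y : process O R m -> process O R r) : set (process O R m) :=
  [set v | controls lambda v /\ adapted T (joint_filtration (Y v)) v].

Definition running_cost (Z : process O R n) (v : process O R m) (t : R)
    (w : O) : R :=
  let l := theta t w in
  let z := Z t w in let zh := Etheta Z t w in
  let u := v t w in let uh := Etheta v t w in
  inner z (wH q l t *m z) + 2 * inner u (wG q l t *m z)
  + inner u (wR q l t *m u)
  + inner zh (wHh q l t *m zh) + 2 * inner uh (wGh q l t *m zh)
  + inner uh (wRh q l t *m uh).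

Definition terminal_cost (Z : process O R n) (w : O) : R :=
  let l := theta T w in
  let z := Z T w in let zh := Etheta Z T w in
  inner z (wS q l *m z) + inner zh (wSh q l *m zh).

Definition cost (Z : process O R n) (v : process O R m) : \bar R :=
  ((2^-1)%:E * \int[P]_w (\int[mu]_(t in `[0%R, T]) (running_cost Z v t w)%:E
                          + (terminal_cost Z w)%:E))%E.

(* Xf is the filter of X given the observation Y and the chain *)
Definition is_filter (X : process O R n) (Y : process O R r)
    (Xf : process O R n) : Prop :=
  is_cond_process P T (joint_filtration Y) X Xf.

End control_problem.

(* Main.v *)
Require Import Defs.
From mathcomp Require Import all_boot all_order all_algebra.
From mathcomp Require Import all_classical all_reals all_analysis.
From mathcomp Require Import measurable_realfun.
From mathcomp Require Import ring lra.
Import Order.TTheory GRing.Theory Num.Theory.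
Import numFieldNormedType.Exports.

Set Implicit Arguments.
Unset Strict Implicit.
Unset Printing Implicit Defensive.

Local Open Scope classical_set_scope.
Local Open Scope ring_scope.

(** On the admissible controls the two cost functionals differ by a constant, so
    they are minimized by the same controls. The constant is the quadratic cost
    of the estimation error X^v - E[X^v | Y^v, theta], and everything rests on
    the fact that this error does not depend on v.

    The state is affine in the control and the noise is additive: X^v - eta
    solves a linear equation without stochastic integrals, whose coefficients
    and inhomogeneity are functions of the control and of the chain. It is
    therefore measurable with respect to the past of any observation to which v
    is adapted ([state_diff_vgmeas]). Since Y^v - lambda is an integral of
    X^v - eta, it is known both from Y^v and from lambda, so that Y^v and lambda
    generate, together with the chain, the same sigma-algebras
    ([joint_filtration_eq]). All filters are thus conditional expectations with
    respect to one and the same filtration, to which X^u - X^v is adapted;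
    filtering leaves this difference unchanged, whence
    [filter_error_indep].

    At each time the error is orthogonal to every square integrable function of
    the observation. Writing X^v as filter plus error in the quadratic cost, the
    mixed terms have mean zero, and by the tower property X^v and its filter have
    the same conditional mean given the chain. This gives
    cost X^v = cost of the filter + cost of the error ([cost_filter]).

    The analytic point is the measurability of the solution of a linear equation
    whose data are only adapted and jointly measurable. It is obtained by
    duality: for a sigma-algebra G containing the null sets, a square integrable
    Z is G-measurable as soon as E[Z h] = 0 for every square integrable h with
    E[h | G] = 0 ([gmeas_of_orth]). Such pairings commute with integration in
    time, and for the solution Z of the equation the numbers E[Z_s h] satisfy a
    Gronwall estimate that forces them to vanish ([ode_orth_bound]). *)

(** * Integrals of real functions *)

Lemma subitv {R : realType} (s t u : R) :
  s \in `[0, t] -> t \in `[0, u] -> s \in `[0, u].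
Proof. by rewrite !in_itv /= => /andP[-> st] /andP[_ /(le_trans st) ->]. Qed.

Section real_integrable.
Context {R : realType} {d : measure_display} {T : measurableType d}.
Variables (mu : {measure set T -> \bar R}) (D : set T) (mD : measurable D).
Implicit Types f g : T -> R.
Local Notation integ f := (mu.-integrable D (EFin \o f)).

Lemma integD f g : integ f -> integ g -> integ (fun x => f x + g x).
Proof. by move=> fi gi; exact: (integrableD mD fi gi). Qed.

Lemma integZ (k : R) f : integ f -> integ (fun x => k * f x).
Proof. by move=> fi; exact: (integrableZl mD k fi). Qed.

Lemma integN f : integ f -> integ (fun x => - f x).
Proof. by move=> /(integZ (-1)); under eq_fun do rewrite mulN1r. Qed.

Lemma integB f g : integ f -> integ g -> integ (fun x => f x - g x).
Proof. by move=> fi gi; apply: integD fi _; exact: integN. Qed.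

Lemma integ_sum (I : Type) (s : seq I) (F : I -> T -> R) :
  (forall i, integ (F i)) -> integ (fun x => \sum_(i <- s) F i x).
Proof.
move=> iF; elim: s => [|i s ih].
  by under eq_fun do rewrite big_nil; exact: integrable0.
by under eq_fun do rewrite big_cons; exact: integD.
Qed.

Lemma Rintegral_sum (I : Type) (s : seq I) (F : I -> T -> R) :
  (forall i, integ (F i)) ->
  \int[mu]_(x in D) (\sum_(i <- s) F i x) = \sum_(i <- s) \int[mu]_(x in D) F i x.
Proof.
move=> iF; elim: s => [|i s ih].
  by under eq_Rintegral do rewrite big_nil; rewrite big_nil /Rintegral integral0.
under eq_Rintegral do rewrite big_cons.
by rewrite big_cons -ih RintegralD//; exact: integ_sum.
Qed.

Lemma integ_le f g : measurable_fun D f -> integ g ->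
  (forall x, D x -> `|f x| <= `|g x|) -> integ f.
Proof.
move=> mf gi fg; apply: (le_integrable mD) gi; first exact/measurable_EFinP.
by move=> x Dx; rewrite !abse_EFin lee_fin; exact: fg.
Qed.

Lemma integ_measurable f : integ f -> measurable_fun D f.
Proof. by move=> fi; apply/measurable_EFinP; exact: measurable_int fi. Qed.

Lemma EFin_Rintegral f : integ f ->
  (\int[mu]_(x in D) f x)%:E = (\int[mu]_(x in D) (f x)%:E)%E.
Proof. by move=> fi; rewrite /Rintegral fineK//; exact: integrable_fin_num. Qed.

End real_integrable.

(** * Measurability and orthogonality relative to a sub-sigma-algebra *)

Section sub_sigma_algebra.
Context {R : realType} {dO : measure_display} {O : measurableType dO}.
Variable P : probability O R.
Implicit Types (f g h Z : O -> R) (G : set (set O)).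

Local Notation integ f := (P.-integrable setT (EFin \o f)).

(** The sigma-algebra is given by generators, so that the carrier equipped with
    it is a measurable type and the closure properties of measurable functions
    apply. *)
Definition gmeas G (f : O -> R) : Prop :=
  measurable_fun setT (f : g_sigma_algebraType G -> R).

Lemma gmeasP G f :
  gmeas G f <-> forall B : set R, measurable B -> <<s G >> (f @^-1` B).
Proof.
split=> [mf B mB|mf _ B mB]; last by rewrite setTI; exact: mf.
by rewrite -[X in <<s G >> X]setTI; exact: mf.
Qed.

Lemma gmeas_sub G G' f : <<s G >> `<=` <<s G' >> -> gmeas G f -> gmeas G' f.
Proof.
by move=> GG' /gmeasP mf; apply/gmeasP => B mB; apply: GG'; exact: mf.
Qed.

Lemma gmeas_measurable G f : <<s G >> `<=` measurable -> gmeas G f ->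
  measurable_fun setT f.
Proof.
by move=> GG' /gmeasP mf _ B mB; rewrite setTI; apply: GG'; exact: mf.
Qed.

Lemma gmeas_cst G (k : R) : gmeas G (fun _ : O => k).
Proof. exact: measurable_cst. Qed.

Lemma gmeasD G f g : gmeas G f -> gmeas G g -> gmeas G (fun w => f w + g w).
Proof. exact: (@measurable_funD _ (g_sigma_algebraType G)). Qed.

Lemma gmeasM G f g : gmeas G f -> gmeas G g -> gmeas G (fun w => f w * g w).
Proof. exact: (@measurable_funM _ (g_sigma_algebraType G)). Qed.

Lemma gmeasB G f g : gmeas G f -> gmeas G g -> gmeas G (fun w => f w - g w).
Proof. exact: (@measurable_funB _ (g_sigma_algebraType G)). Qed.

Lemma gmeas_sum G (I : Type) (s : seq I) (F : I -> O -> R) :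
  (forall i, gmeas G (F i)) -> gmeas G (fun w => \sum_(i <- s) F i w).
Proof.
move=> mF; elim: s => [|i s ih].
  by under eq_fun do rewrite big_nil; exact: gmeas_cst.
by under eq_fun do rewrite big_cons; exact: gmeasD.
Qed.

Lemma gmeas_indic G A : <<s G >> A -> gmeas G (\1_A : O -> R).
Proof. by move=> GA; exact: (@measurable_indic _ (g_sigma_algebraType G)). Qed.

(** E[h | G] = 0, without reference to a version of the conditional
    expectation. *)
Definition orth G (h : O -> R) : Prop :=
  integ h /\ forall A, <<s G >> A -> (\int[P]_(w in A) (h w)%:E = 0)%E.

(** Layer cake: f w is the length of [0, f w[, so by Fubini the integral of f h
    is the integral over x >= 0 of the integrals of h over the sets x < f, and
    these sets belong to the sigma-algebra. *)
Lemma orth_mul_ge0 G f h : <<s G >> `<=` measurable -> orth G h ->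
  gmeas G f -> (forall w, 0 <= f w) -> integ (fun w => f w * h w) ->
  (\int[P]_w (f w * h w)%:E = 0)%E.
Proof.
move=> sG [ih oh] mf f0 ifh.
have mf' := gmeas_measurable sG mf.
have mh : measurable_fun setT h by apply/measurable_EFinP; apply: measurable_int ih.
pose b (z : measurableTypeR R * O) : bool := (0 <= z.1) && (z.1 < f z.2).
have mb : measurable_fun setT b.
  apply: measurable_and.
    exact: (@measurable_fun_ler _ _ _ _ (cst 0) fst).
  apply: measurable_fun_ltr => //; exact: measurableT_comp.
have mS : measurable [set z | b z].
  by rewrite -[X in measurable X]setTI; exact: mb.
pose k (z : measurableTypeR R * O) : \bar R := (h z.2 * \1_[set z | b z] z)%:E.
have mk : measurable_fun setT k.
  apply/measurable_EFinP; apply: measurable_funM.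
    exact: measurableT_comp.
  exact: measurable_indic.
have ind x w : \1_[set z | b z] (x, w) = \1_`[0, f w[%classic x :> R.
  by rewrite !indicE; congr (_%:R); congr nat_of_bool.
have inner (c : R) w :
    (\int[lebesgue_measure]_x (c * \1_[set z | b z] (x, w))%:E = (c * f w)%:E)%E.
  under eq_integral do rewrite ind EFinM.
  rewrite integralZl//; last exact: integrable_indic_itv.
  rewrite integral_indic// setIT /= lebesgue_measure_itv /= lte_fin.
  case: ltP => [_|]; first by rewrite sube0 EFinM.
  by move=> f0'; have -> : f w = 0 by apply/eqP; rewrite eq_le f0 f0'.
have ik : (lebesgue_measure \x P)%E.-integrable setT k.
  apply/integrable21ltyP => //.
  under eq_integral => w _.
    under eq_integral => x _.
      rewrite /k /= normrM (ger0_norm (_ : 0 <= \1_[set z | b z] (x, w)));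
        last by rewrite indicE.
    over.
    rewrite inner mulrC -[in X in X * _](ger0_norm (f0 w)) -normrM; over.
  by move/integrableP : ifh => [].
have := Fubini ik.
rewrite [X in X = _ -> _](_ : _ = 0%E); last first.
  rewrite [X in (\int[_]_x X x)%E](_ : _ = cst 0%E) ?integral0//.
  apply/funext => x; rewrite /k /=.
  have [x0|x0] := leP 0 x; last first.
    rewrite -[RHS](integral0 P setT); apply: eq_integral => w _.
    by rewrite ind indicE memNset ?mulr0//= in_itv/= lt_geF.
  rewrite -[RHS](oh [set w | x < f w]); last first.
    have := mf measurableT `]x, +oo[%classic (measurable_itv _).
    rewrite setTI; congr (<<s G >> _).
    by apply/seteqP; split=> w /=; rewrite in_itv /= andbT.
  rewrite [RHS]integral_mkcond; apply: eq_integral => w _.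
  rewrite patchE ind indicE /=.
  case: ifPn => [/set_mem /= xf|/negP xf].
    by rewrite mem_set ?mulr1 //= in_itv /= x0 xf.
  rewrite memNset ?mulr0 // /= in_itv /= x0 /= => xf'; apply: xf.
  exact: mem_set.
move=> e; rewrite [RHS]e; apply: eq_integral => w _.
by rewrite /k /= inner mulrC.
Qed.

Lemma orth_mul G f h : <<s G >> `<=` measurable -> orth G h ->
  gmeas G f -> integ (fun w => f w * h w) ->
  \int[P]_w (f w * h w) = 0.
Proof.
move=> sG oh mf ifh; have [ih _] := oh.
pose p w := Num.max (f w) 0; pose n w := Num.max (- f w) 0.
have mp : gmeas G p by apply: measurable_maxr => //; exact: measurable_cst.
have mn : gmeas G n.
  apply: measurable_maxr; last exact: measurable_cst.
  exact: (measurable_funN (mf : measurable_fun setT (f : g_sigma_algebraType G -> R))).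
have fpn w : f w = p w - n w by rewrite /p /n; case: leP => ?; case: leP => ?; lra.
have mh : measurable_fun setT h.
  by apply/measurable_EFinP; exact: measurable_int ih.
have ip k : gmeas G k -> (forall w, `|k w| <= `|f w|) -> integ (fun w => k w * h w).
  move=> mk kf; apply: le_integrable ifh => //.
    by apply/measurable_EFinP/measurable_funM => //; exact: gmeas_measurable mk.
  by move=> w _; rewrite !abse_EFin lee_fin !normrM ler_wpM2r.
have ip1 : integ (fun w => p w * h w).
  apply: ip => // w; rewrite /p; by case: (leP (f w)) => _; rewrite ?normr0.
have ip2 : integ (fun w => n w * h w).
  apply: ip => // w; by rewrite /n; case: (leP (- f w)) => _; rewrite ?normr0 ?normrN.
rewrite /Rintegral.
under eq_integral do rewrite fpn mulrBl EFinB.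
rewrite integralB// (orth_mul_ge0 sG oh mp)// ?(orth_mul_ge0 sG oh mn)// ?sube0//.
- by move=> w; rewrite /n le_max lexx orbT.
- by move=> w; rewrite /p le_max lexx orbT.
Qed.

(** The Radon-Nikodym theorem on the coarser measurable space: the charge with
    density Z and the probability are both transported along the identity. *)
Lemma cond_exp_exists G Z : <<s G >> `<=` measurable -> integ Z ->
  exists Z', [/\ gmeas G Z', integ Z' & orth G (fun w => Z w - Z' w)].
Proof.
move=> sG iZ.
pose GT := g_sigma_algebraType G.
pose i : O -> GT := id.
have mi : measurable_fun setT i by move=> _ B mB; rewrite setTI; exact: sG.
pose X : {RV P >-> GT} := mfun_Sub (mem_set mi).
pose Q : probability GT R := distribution P X.
pose nu : {charge set O -> \bar R} := induced_charge iZ.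
have [Nu NuE] : exists Nu : {charge set GT -> \bar R},
    forall A, measurable A -> Nu A = (\int[P]_(w in A) (Z w)%:E)%E.
  pose Nu : {charge set GT -> \bar R} := pushforward nu i.
  by exists (Nu mi).
have NuQ : Nu `<< Q.
  apply/null_content_dominatesP => A mA QA; rewrite NuE//.
  apply: null_set_integral => //; first exact: sG.
  exact/measurable_funTS/(measurable_int _ iZ).
pose D := Radon_Nikodym Nu Q.
have iD : Q.-integrable setT D by exact: Radon_Nikodym_integrable.
have Dfin x : D x \is a fin_num by exact: Radon_Nikodym_fin_num.
have mD0 : measurable_fun setT D by exact: measurable_int iD.
have mD : gmeas G (fine \o D) by exact: measurableT_comp.
have mD' := gmeas_measurable sG mD.
have DK : EFin \o (fine \o D) = D :> (O -> \bar R).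
  by apply/funext => w; rewrite /= fineK.
have iDP : integ (fine \o D).
  apply/integrableP; split; first exact/measurable_EFinP.
  rewrite DK; move/integrableP : iD => [_]; rewrite ge0_integral_pushforward//.
  exact: measurableT_comp.
have DE A : <<s G >> A ->
    (\int[P]_(w in A) (fine (D w))%:E = \int[P]_(w in A) (Z w)%:E)%E.
  move=> GA; rewrite -NuE// (Radon_Nikodym_integral NuQ)// -/D.
  rewrite integral_pushforward//.
    by apply: eq_integral => w _; rewrite /= fineK.
  apply: (integrableS measurableT) => //; first exact: sG.
  by rewrite -[D \o X]DK.
exists (fine \o D); split => //; split; first exact: integB.
move=> A GA; have mA := sG _ GA.
under eq_integral do rewrite EFinB.
rewrite integralB//; try exact: (integrableS measurableT).
rewrite DE// subee//; apply: integrable_fin_num => //.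
exact: (integrableS measurableT).
Qed.

(** * Square integrable random variables *)

Definition L2 (f : O -> R) : Prop :=
  measurable_fun setT f /\ integ (fun w => f w ^+ 2).

Lemma L2M f g : L2 f -> L2 g -> integ (fun w => f w * g w).
Proof.
move=> [mf if2] [mg ig2].
apply: integ_le (integD measurableT if2 ig2) _ => //; first exact: measurable_funM.
move=> w _; rewrite (ger0_norm (addr_ge0 (sqr_ge0 _) (sqr_ge0 _))) ler_norml.
have := sqr_ge0 (f w + g w); have := sqr_ge0 (f w - g w).
by rewrite sqrrB sqrrD; move=> ? ?; apply/andP; split; nra.
Qed.

Lemma L2_cst (k : R) : L2 (fun _ => k).
Proof. by split; [exact: measurable_cst|exact: finite_measure_integrable_cst]. Qed.

Lemma L2_integrable f : L2 f -> integ f.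
Proof. by move=> /(L2M (L2_cst 1)); under eq_fun do rewrite mul1r. Qed.

Lemma L2bM (a : O -> R) (K : R) f : measurable_fun setT a ->
  (forall w, `|a w| <= K) -> L2 f -> L2 (fun w => a w * f w).
Proof.
move=> ma aK [mf if2]; split; first exact: measurable_funM.
apply: integ_le (integZ measurableT (K ^+ 2) if2) _ => //.
  by apply: measurable_funX; exact: measurable_funM.
move=> w _; rewrite (ger0_norm (sqr_ge0 _)) (ger0_norm (mulr_ge0 (sqr_ge0 _) (sqr_ge0 _))).
rewrite exprMn ler_wpM2r ?sqr_ge0//.
have K0 : 0 <= K by exact: le_trans (aK w).
by rewrite -(real_normK (num_real (a w))) lerXn2r// nnegrE.
Qed.

Lemma L2Z (k : R) f : L2 f -> L2 (fun w => k * f w).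
Proof. by apply: (@L2bM (cst k) `|k|). Qed.

Lemma L2D f g : L2 f -> L2 g -> L2 (fun w => f w + g w).
Proof.
move=> Lf Lg; have [[mf if2] [mg ig2]] := (Lf, Lg).
split; first exact: measurable_funD.
under eq_fun do rewrite sqrrD.
apply: integD => //; apply: integD => //.
under eq_fun do rewrite -mulr_natl.
by apply: integZ => //; exact: L2M.
Qed.

Lemma L2N f : L2 f -> L2 (fun w => - f w).
Proof. by move=> /(L2Z (-1)); under eq_fun do rewrite mulN1r. Qed.

Lemma L2B f g : L2 f -> L2 g -> L2 (fun w => f w - g w).
Proof. by move=> Lf Lg; apply: L2D Lf _; exact: L2N. Qed.

(** Testing Z - Z' against the truncations of Z', which are bounded, gives
    E[tr^2] = E[tr Z] <= (E[tr^2] + E[Z^2]) / 2; let the truncation level go to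
    infinity. *)
Lemma cond_exp_contraction G Z Z' : <<s G >> `<=` measurable ->
  L2 Z -> gmeas G Z' -> orth G (fun w => Z w - Z' w) ->
  L2 Z' /\ \int[P]_w (Z' w ^+ 2) <= \int[P]_w (Z w ^+ 2).
Proof.
move=> sG LZ mZ' oZ; have [mZ iZ2] := LZ.
have mZ'' := gmeas_measurable sG mZ'.
pose tr (n : nat) w := if `|Z' w| <= n%:R then Z' w else 0.
have mtr n : gmeas G (tr n).
  apply: (@measurable_fun_ifT _ _ (g_sigma_algebraType G) R Z' (cst 0)
    (fun w => `|Z' w| <= n%:R)) => //.
  apply: measurable_fun_ler => //; exact: measurableT_comp.
have trn n w : `|tr n w| <= n%:R by rewrite /tr; case: ifP; rewrite ?normr0.
have Ltr n : L2 (tr n).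
  rewrite (_ : tr n = fun w => tr n w * (cst 1 w)); last first.
    by apply/funext => w; rewrite mulr1.
  apply: (@L2bM _ n%:R) => //; first exact: gmeas_measurable (mtr n).
  exact: L2_cst.
have trE n w : tr n w ^+ 2 = tr n w * Z' w.
  by rewrite /tr; case: ifP; rewrite ?mul0r ?expr0n.
have bnd n : \int[P]_w (tr n w ^+ 2) <= \int[P]_w (Z w ^+ 2).
  have iZt := L2M (Ltr n) LZ.
  have i2 := (Ltr n).2.
  have io : integ (fun w => tr n w * (Z w - Z' w)).
    by under eq_fun do rewrite mulrBr -trE; exact: integB.
  have := orth_mul sG oZ (mtr n) io.
  under eq_Rintegral do rewrite mulrBr -trE.
  rewrite RintegralB// => /eqP; rewrite subr_eq0 => /eqP e.
  have : \int[P]_w (2 * (tr n w * Z w)) <= \int[P]_w (tr n w ^+ 2 + Z w ^+ 2).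
    apply: le_Rintegral => //; [exact: integZ|exact: integD|].
    by move=> w _; have := sqr_ge0 (tr n w - Z w); rewrite sqrrB; lra.
  rewrite RintegralZl// RintegralD// e; lra.
have key : (\int[P]_w (Z' w ^+ 2)%:E <= (\int[P]_w (Z w ^+ 2))%:E)%E.
  pose g' n w := (tr n w ^+ 2)%:E.
  have mg' n : measurable_fun setT (g' n).
    by apply/measurable_EFinP/measurable_funX; exact: gmeas_measurable (mtr n).
  have g'0 n w : setT w -> (0 <= g' n w)%E by move=> _; rewrite lee_fin sqr_ge0.
  have nd w : setT w -> {homo g'^~ w : n m / (n <= m)%N >-> (n <= m)%E}.
    move=> _ k l kl; rewrite lee_fin /tr; case: ifP => [Zk|_]; last first.
      by rewrite expr0n sqr_ge0.
    by rewrite (le_trans Zk) ?ler_nat.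
  have := cvg_monotone_convergence measurableT mg' g'0 nd (mu := P).
  rewrite (_ : (fun w => limn (g'^~ w)) = fun w => (Z' w ^+ 2)%:E); last first.
    apply/funext => w; apply/cvg_lim => //; apply: cvg_near_cst.
    near=> k; rewrite /g' /tr ifT//; near: k; exact: nbhs_infty_ger.
  move=> cg; rewrite -(cvg_lim _ cg)//; apply: lime_le; first exact: cvgP cg.
  by apply: nearW => n; rewrite /g' -EFin_Rintegral ?lee_fin//; exact: (Ltr n).2.
have iZ'2 : integ (fun w => Z' w ^+ 2).
  apply/integrableP; split; first exact/measurable_EFinP/measurable_funX.
  under eq_integral do rewrite /= ger0_norm ?sqr_ge0//.
  exact: le_lt_trans key (ltry _).
by split => //; rewrite -lee_fin EFin_Rintegral.
Unshelve. all: by end_near. Qed.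

Lemma gmeas_ae G f g : P.-negligible `<=` <<s G >> ->
  {ae P, forall w, f w = g w} -> gmeas G f -> gmeas G g.
Proof.
move=> nG fg /gmeasP mf; apply/gmeasP => B mB.
have -> : g @^-1` B = (f @^-1` B `\` [set w | f w <> g w])
                     `|` (g @^-1` B `&` [set w | f w <> g w]).
  apply/seteqP; split => w /=.
    by have [<-|fgw] := pselect (f w = g w); [left; split=> // + ; exact|right].
  by move=> [[Bf /contrapT <-]|[]].
have mN : <<s G >> [set w | f w <> g w] by exact: nG.
rewrite -/(@measurable _ (g_sigma_algebraType G)).
apply: (@measurableU _ (g_sigma_algebraType G)).
  by apply: (@measurableD _ (g_sigma_algebraType G)) => //; exact: mf.
by apply: nG; apply: negligibleS fg => w [].
Qed.

Lemma L2_eq0 f : L2 f -> \int[P]_w (f w ^+ 2) = 0 -> {ae P, forall w, f w = 0}.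
Proof.
move=> [mf if2] f0.
have e : (\int[P]_w `|(f w ^+ 2)%:E| = 0)%E.
  under eq_integral do rewrite abse_EFin ger0_norm ?sqr_ge0//.
  by rewrite -EFin_Rintegral// f0.
have [+ _] := ae_eq_integral_abs P measurableT (measurable_int _ if2).
move=> /(_ e); apply: filterS => w /(_ I) /= [] /eqP.
by rewrite sqrf_eq0 => /eqP.
Qed.

(** Test with h = Z - E[Z | G]: both E[Z h] and E[E[Z | G] h] vanish, hence so
    does E[h^2]. This criterion turns the measurability of a random variable
    into linear conditions that can be integrated in time. *)
Lemma gmeas_of_orth G Z : <<s G >> `<=` measurable ->
  P.-negligible `<=` <<s G >> -> L2 Z ->
  (forall h, L2 h -> orth G h -> \int[P]_w (Z w * h w) = 0) -> gmeas G Z.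
Proof.
move=> sG nG LZ Zh; have [Z' [mZ' iZ' oZ]] := cond_exp_exists sG (L2_integrable LZ).
have [LZ' _] := cond_exp_contraction sG LZ mZ' oZ.
have Lh := L2B LZ LZ'.
have e1 := Zh _ Lh oZ.
have e2 := orth_mul sG oZ mZ' (L2M LZ' Lh).
have e3 : \int[P]_w ((Z w - Z' w) ^+ 2) = 0.
  under eq_Rintegral do rewrite expr2 mulrBl.
  by rewrite RintegralB// ?e1 ?e2 ?subr0//; exact: L2M.
apply: gmeas_ae mZ' => //; apply: filterS (L2_eq0 Lh e3) => w /eqP.
by rewrite subr_eq0 => /eqP.
Qed.

End sub_sigma_algebra.

(** * Integrals of processes with respect to time *)

Section process_integrals.
Context {R : realType} {dO : measure_display} {O : measurableType dO}.
Variables (P : probability O R) (T : R).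
Implicit Types (a b : R -> O -> R) (h : O -> R).

Local Notation mu := (@lebesgue_measure R).
Local Notation integ f := (P.-integrable setT (EFin \o f)).
Local Notation DT := (`[0, T]%classic `*` [set: O] : set (measurableTypeR R * O)).

Definition jmeas a : Prop :=
  measurable_fun DT (fun z : measurableTypeR R * O => a z.1 z.2).

(** The bound on the moments is uniform in time: this makes the process
    integrable on [0, T] x O and yet is meaningful at each single time. *)
Definition L1proc a : Prop := jmeas a /\ exists K : R,
  forall t, t \in `[0, T] -> integ (a t) /\ \int[P]_w `|a t w| <= K.

Definition L2proc a : Prop := jmeas a /\ exists K : R,
  forall t, t \in `[0, T] -> L2 P (a t) /\ \int[P]_w (a t w ^+ 2) <= K.

Lemma measurable_DT : measurable DT.
Proof. by apply: measurableX => //; exact: measurable_itv. Qed.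

Lemma jmeas_section a t : jmeas a -> t \in `[0, T] -> measurable_fun setT (a t).
Proof.
move=> ma tT; rewrite (_ : a t = (fun z => a z.1 z.2) \o (fun w => (t, w)))//.
apply: (measurable_comp measurable_DT) ma _; last exact: measurable_pair1.
by move=> _ [w _ <-].
Qed.

Lemma L2proc_L2 a t : L2proc a -> t \in `[0, T] -> L2 P (a t).
Proof. by move=> [_ [K aK]] /aK[]. Qed.

Lemma L1proc_integrable a t : L1proc a -> t \in `[0, T] -> integ (a t).
Proof. by move=> [_ [K aK]] /aK[]. Qed.

(** The last conclusion concerns the integral in the extended reals, which is
    the one in the definition of the cost; it agrees with the real integral of
    the second conclusion only outside a null set. *)
Lemma Fubini_process a s : L1proc a -> s <= T ->
  [/\ {ae P, forall w, mu.-integrable `[0, s] (EFin \o a ^~ w)},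
      integ (fun w => \int[mu]_(r in `[0, s]) a r w),
      mu.-integrable `[0, s] (EFin \o (fun r => \int[P]_w a r w)),
      \int[P]_w (\int[mu]_(r in `[0, s]) a r w) =
      \int[mu]_(r in `[0, s]) (\int[P]_w a r w) &
      measurable_fun setT (fun w => \int[mu]_(r in `[0%R, s]) (a r w)%:E)%E].
Proof.
move=> [ma [K aK]] sT.
pose D := (`[0, s]%classic `*` [set: O] : set (measurableTypeR R * O)).
have mI : measurable (`[0, s]%classic : set (measurableTypeR R)) by exact: measurable_itv.
have mD : measurable D by exact: measurableX.
have sub r : r \in `[0, s] -> r \in `[0, T].
  by rewrite !in_itv /= => /andP[-> /le_trans ->].
(* the process, extended by zero to all times *)
pose k := (fun z : measurableTypeR R * O => (a z.1 z.2)%:E) \_ D.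
have mk : measurable_fun setT k.
  apply: (measurable_restrictT _ mD).1; apply: measurableT_comp => //.
  apply: (measurable_funS measurable_DT) ma.
  by move=> [r w] [/= rs _]; split => //=; exact: sub.
have kE r w : k (r, w) = if r \in `[0, s] then (a r w)%:E else 0%E.
  rewrite /k patchE /D; case: ifPn => [/set_mem [/= rs _]|/negP rs].
    by move: rs; rewrite /= => ->.
  by case: ifPn => // rs'; exfalso; apply: rs; apply/mem_set; split.
have kE2 w : (fun r => k (r, w)) = (EFin \o a ^~ w) \_ `[0, s].
  by apply/funext => r; rewrite kE patchE; congr (if _ then _ else _); rewrite mem_setE.
have ik : (mu \x P)%E.-integrable setT k.
  apply/integrable12ltyP => //.
  apply: (@le_lt_trans _ _ (\int[mu]_x ((cst K%:E) \_ `[0%R, s]) x)%E).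
    apply: ge0_le_integral => //.
    - by move=> r _; exact: integral_ge0.
    - apply: (measurable_fun_fubini_tonelli_F (abse \o k)) => //=; exact: measurableT_comp.
    - apply/(measurable_restrictT _ _).1 => //; exact: measurable_cst.
    move=> r _; rewrite patchE; under eq_integral do rewrite kE.
    rewrite mem_setE; case: ifPn => rs; last first.
      by under eq_integral do rewrite abse0; rewrite integral0.
    have [ia iK] := aK _ (sub _ rs).
    under eq_integral do rewrite abse_EFin.
    rewrite -EFin_Rintegral ?lee_fin//.
    by have := integrable_norm ia.
  rewrite -integral_mkcond integral_cst// /= lebesgue_measure_itv/=.
  by case: ifP => _; rewrite -?EFinB ?mule0 ?ltry// -EFinM ltry.
have ikF := integrable_fubini_F ik.
have mG : measurable_fun setT (fubini_G mu k) by exact: (measurable_fubini_G ik).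
have ikG : P.-integrable setT (fubini_G mu k).
  apply/integrableP; split => //.
  apply: le_lt_trans ((integrable21ltyP mu P mk).1 ik).
  apply: ge0_le_integral => //.
  - exact: measurableT_comp.
  - apply: (measurable_fun_fubini_tonelli_G (abse \o k)) => //=; exact: measurableT_comp.
  - move=> w _; apply: le_abse_integral => //; exact: measurableT_comp.
have FE : fubini_F P k = (EFin \o (fun r => \int[P]_w a r w)) \_ `[0, s].
  apply/funext => r; rewrite /fubini_F patchE mem_setE.
  under eq_integral do rewrite kE.
  case: ifPn => rs; last by rewrite integral0.
  by rewrite /= EFin_Rintegral//; exact: (aK _ (sub _ rs)).1.
have GE w : fine (fubini_G mu k w) = \int[mu]_(r in `[0, s]) a r w.
  by rewrite /fubini_G kE2 -integral_mkcond.
have iG : integ (fun w => \int[mu]_(r in `[0, s]) a r w).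
  under eq_fun do rewrite -GE.
  apply: le_integrable ikG => //.
    by apply/measurable_EFinP; exact: measurableT_comp.
  by move=> w _ /=; case: (fubini_G mu k w) => //=; rewrite normr0 leey.
split => //.
- apply: filterS (ae_integrable2 ik) => w; rewrite kE2 => iw.
  exact/(integrable_mkcond _ mI).2.
- by apply/(integrable_mkcond _ mI).2; rewrite -FE.
- rewrite /Rintegral; congr fine.
  transitivity (\int[P]_w fubini_G mu k w)%E.
    apply: ae_eq_integral => //; first exact: measurable_int iG.
    apply: filterS (integrable_ae measurableT ikG) => w Gf _.
    by rewrite -[RHS](fineK (Gf I)) GE.
  rewrite [RHS]integral_mkcond.
  transitivity (\int[mu]_x fubini_F P k x)%E; first by rewrite /fubini_F Fubini.
  rewrite FE; apply: eq_integral => r _; rewrite !patchE; case: ifPn => // rs.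
- have GE' w : fubini_G mu k w = (\int[mu]_(r in `[0%R, s]) (a r w)%:E)%E.
    by rewrite /fubini_G kE2 -integral_mkcond.
  by rewrite -(eq_fun GE').
Qed.

Lemma L2proc_M a b : L2proc a -> L2proc b -> L1proc (fun t w => a t w * b t w).
Proof.
move=> [ma [K aK]] [mb [K' bK]]; split; first exact: measurable_funM.
exists (K + K') => t tT; have [La iaK] := aK _ tT; have [Lb ibK] := bK _ tT.
have iab := L2M La Lb; split => //.
apply: le_trans (lerD iaK ibK); rewrite -RintegralD//; [|exact: La.2|exact: Lb.2].
apply: le_Rintegral => //; first exact: integrable_norm iab.
  by apply: integD => //; [exact: La.2|exact: Lb.2].
move=> w _; rewrite ler_norml.
have := sqr_ge0 (a t w + b t w); have := sqr_ge0 (a t w - b t w).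
by rewrite sqrrB sqrrD; move=> ? ?; apply/andP; split; nra.
Qed.

Lemma L2proc_cst h : L2 P h -> L2proc (fun _ => h).
Proof.
move=> Lh; split; last by exists (\int[P]_w (h w ^+ 2)).
apply: (measurable_comp measurableT) => //; first exact: Lh.1.
apply: measurable_funTS; exact: measurable_snd.
Qed.

Lemma L2proc_L1 a : L2proc a -> L1proc a.
Proof.
move=> /L2proc_M /(_ (L2proc_cst (L2_cst P 1))).
rewrite (_ : (fun t w => a t w * 1) = a)//.
by apply/funext => t; apply/funext => w; rewrite mulr1.
Qed.

Lemma L2proc_Mh a h : L2proc a -> L2 P h -> L1proc (fun t w => a t w * h w).
Proof. by move=> La Lh; exact: L2proc_M (L2proc_cst Lh). Qed.

Lemma L1proc_D a b : L1proc a -> L1proc b -> L1proc (fun t w => a t w + b t w).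
Proof.
move=> [ma [K aK]] [mb [K' bK]]; split; first exact: measurable_funD.
exists (K + K') => t tT; have [ia iaK] := aK _ tT; have [ib ibK] := bK _ tT.
have iab := integD measurableT ia ib; split => //.
have ian := integrable_norm ia; have ibn := integrable_norm ib.
apply: le_trans (lerD iaK ibK); rewrite -RintegralD//.
apply: le_Rintegral => //; first exact: integrable_norm iab.
  exact: integD.
by move=> w _; exact: ler_normD.
Qed.

Lemma L2proc_D a b : L2proc a -> L2proc b -> L2proc (fun t w => a t w + b t w).
Proof.
move=> [ma [K aK]] [mb [K' bK]]; split; first exact: measurable_funD.
exists (2 * K + 2 * K') => t tT; have [La iaK] := aK _ tT; have [Lb ibK] := bK _ tT.
have Lab := L2D La Lb; split => //.
have [_ ia] := La; have [_ ib] := Lb; have [_ iab] := Lab.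
have le2 : 2 * \int[P]_w (a t w ^+ 2) + 2 * \int[P]_w (b t w ^+ 2) <= 2 * K + 2 * K'.
  by rewrite lerD// ler_wpM2l.
apply: le_trans le2; rewrite -!RintegralZl// -RintegralD//; [|exact: integZ..].
apply: le_Rintegral => //; first by apply: integD => //; exact: integZ.
by move=> w _; have := sqr_ge0 (a t w - b t w); rewrite sqrrB sqrrD; lra.
Qed.

(** Multipliers of square integrable processes. *)
Definition bproc a : Prop := jmeas a /\ exists K : R,
  forall t, t \in `[0, T] -> forall w, `|a t w| <= K.

Lemma L2proc_bM a b : bproc a -> L2proc b -> L2proc (fun t w => a t w * b t w).
Proof.
move=> [ma [K aK]] [mb [K' bK]]; split; first exact: measurable_funM.
exists (K ^+ 2 * K') => t tT; have [Lb ibK] := bK _ tT.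
have mat := jmeas_section ma tT.
have Lab := L2bM mat (aK _ tT) Lb; split => //.
have [_ ib] := Lb.
apply: (@le_trans _ _ (K ^+ 2 * \int[P]_w (b t w ^+ 2))); last by rewrite ler_wpM2l ?sqr_ge0.
rewrite -RintegralZl//; apply: le_Rintegral => //; [exact: Lab.2|exact: integZ|].
move=> w _; rewrite exprMn ler_wpM2r ?sqr_ge0//.
have K0 : 0 <= K by exact: le_trans (aK _ tT w).
by rewrite -(real_normK (num_real (a t w))) lerXn2r// ?nnegrE//; exact: aK.
Qed.

Lemma bproc_cst (k : R) : bproc (fun _ _ => k).
Proof. by split; [exact: measurable_cst|exists `|k|]. Qed.

Lemma L2proc_L2bound a : L2proc a ->
  exists K : R, forall t, t \in `[0, T] -> \int[P]_w (a t w ^+ 2) <= K.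
Proof. by move=> [_ [K aK]]; exists K => t /aK[]. Qed.

Lemma L2proc_Z (k : R) a : L2proc a -> L2proc (fun t w => k * a t w).
Proof. exact: L2proc_bM (bproc_cst k). Qed.

Lemma L2proc_N a : L2proc a -> L2proc (fun t w => - a t w).
Proof.
move=> /(L2proc_Z (-1)); rewrite (_ : (fun t w => -1 * a t w) = (fun t w => - a t w))//.
by apply/funext => t; apply/funext => w; rewrite mulN1r.
Qed.

Lemma L2proc_B a b : L2proc a -> L2proc b -> L2proc (fun t w => a t w - b t w).
Proof. by move=> La /L2proc_N; exact: L2proc_D. Qed.

Lemma L2proc_sum (I : Type) (s : seq I) (F : I -> R -> O -> R) :
  (forall i, L2proc (F i)) -> L2proc (fun t w => \sum_(i <- s) F i t w).
Proof.
move=> LF; elim: s => [|i s ih].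
  rewrite (_ : (fun t w => _) = (fun _ => cst 0)).
    exact: L2proc_cst (L2_cst P 0).
  by apply/funext => t; apply/funext => w; rewrite big_nil.
rewrite (_ : (fun t w => _) = (fun t w => F i t w + \sum_(j <- s) F j t w)).
  exact: L2proc_D.
by apply/funext => t; apply/funext => w; rewrite big_cons.
Qed.

Lemma L1proc_sum (I : Type) (s : seq I) (F : I -> R -> O -> R) :
  (forall i, L1proc (F i)) -> L1proc (fun t w => \sum_(i <- s) F i t w).
Proof.
move=> LF; elim: s => [|i s ih].
  rewrite (_ : (fun t w => _) = (fun _ _ => 0)); last first.
    by apply/funext => t; apply/funext => w; rewrite big_nil.
  exact: L2proc_L1 (L2proc_cst (L2_cst P 0)).
rewrite (_ : (fun t w => _) = (fun t w => F i t w + \sum_(j <- s) F j t w)).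
  exact: L1proc_D.
by apply/funext => t; apply/funext => w; rewrite big_cons.
Qed.

Lemma Rintegral_ae f g : measurable_fun setT f -> measurable_fun setT g ->
  {ae P, forall w, f w = g w} -> \int[P]_w f w = \int[P]_w g w.
Proof.
move=> mf mg fg; rewrite /Rintegral; congr fine.
apply: ae_eq_integral => //; [exact/measurable_EFinP|exact/measurable_EFinP|].
by apply: filterS fg => w /= -> _.
Qed.

(* Cauchy-Schwarz on [0, s] *)
(** Cauchy-Schwarz, from the expansion of the integral of (s f - I)^2, where I
    is the integral of f. *)
Lemma sqr_Rintegral_le (f : R -> R) s : 0 <= s ->
  mu.-integrable `[0, s] (EFin \o f) ->
  mu.-integrable `[0, s] (EFin \o (fun r => f r ^+ 2)) ->
  (\int[mu]_(r in `[0, s]) f r) ^+ 2 <= s * \int[mu]_(r in `[0, s]) (f r ^+ 2).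
Proof.
move=> s0 fi f2i.
have mI : measurable (`[0, s]%classic : set (measurableTypeR R)) by exact: measurable_itv.
set I := \int[mu]_(r in `[0, s]) f r; set J := \int[mu]_(r in _) _.
have cE (c : R) : \int[mu]_(r in `[0, s]) c = c * s.
  rewrite Rintegral_cst//; congr (_ * _); rewrite /= lebesgue_measure_itv /= lte_fin.
  by case: ltP => [|s0']; rewrite /= ?subr0//; apply/eqP; rewrite eq_le s0.
have ic (c : R) : mu.-integrable `[0, s] (EFin \o cst c).
  apply: measurable_bounded_integrable => //; last exact: bounded_cst.
  by rewrite /= lebesgue_measure_itv /=; case: ifP => _; rewrite ?ltry// -EFinB ltry.
have : 0 <= \int[mu]_(r in `[0, s]) (s * f r - I) ^+ 2.
  by apply: Rintegral_ge0 => r _; exact: sqr_ge0.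
rewrite (_ : \int[mu]_(r in `[0, s]) _ = s * (s * J - I ^+ 2)).
  have [s00 _|s_neq0] := eqVneq s 0.
    have I0 : I = 0.
      rewrite /I (_ : [set` `[0, s]] = [set 0]) ?Rintegral_set1//.
      rewrite s00; apply/seteqP; split => [x|x ->] /=; rewrite in_itv /= ?lexx//.
      by rewrite -eq_le => /eqP <-.
    by rewrite I0 s00 expr0n mul0r.
  have {s0 s_neq0} s0 : 0 < s by rewrite lt0r s_neq0.
  by rewrite pmulr_rge0// subr_ge0.
transitivity (\int[mu]_(r in `[0, s]) (s ^+ 2 * f r ^+ 2 + ((- 2 * s * I) * f r + I ^+ 2))).
  by apply: eq_Rintegral => r _; ring.
rewrite RintegralD//; [|exact: integZ|by apply: integD => //; [exact: integZ|exact: ic]].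
rewrite RintegralD//; [|exact: integZ|exact: ic].
rewrite cE (RintegralZl _ mI f2i) (RintegralZl _ mI fi) -/I -/J; ring.
Qed.

Lemma L2_Rintegral a s : L2proc a -> s \in `[0, T] ->
  L2 P (fun w => \int[mu]_(r in `[0, s]) a r w).
Proof.
move=> La; rewrite in_itv /= => /andP[s0 sT].
have [aei i1 _ _ _] := Fubini_process (L2proc_L1 La) sT.
have [aei2 i2 _ _ _] := Fubini_process (L2proc_M La La) sT.
have m1 := integ_measurable i1; have m2 := integ_measurable i2.
split => //; apply/integrableP; split; first exact/measurable_EFinP/measurable_funX.
have /integrableP[_] := integZ measurableT s i2.
apply: le_lt_trans; apply: ae_ge0_le_integral => //.
- by apply/measurable_EFinP; apply: measurableT_comp => //; exact: measurable_funX.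
- by apply/measurable_EFinP; apply: measurableT_comp => //; exact: measurable_funM.
apply: filterS2 aei aei2 => w ai a2i _; rewrite /= lee_fin.
rewrite (ger0_norm (sqr_ge0 _)); apply: le_trans (ler_norm _).
by apply: sqr_Rintegral_le.
Qed.

(** Pairing with a fixed random variable commutes with integration in time. *)
Lemma Rintegral_mulh a h s : L2proc a -> L2 P h -> s \in `[0, T] ->
  mu.-integrable `[0, s] (EFin \o (fun r => \int[P]_w (a r w * h w))) /\
  \int[P]_w ((\int[mu]_(r in `[0, s]) a r w) * h w) =
  \int[mu]_(r in `[0, s]) (\int[P]_w (a r w * h w)).
Proof.
move=> La Lh sT0; have /andP[s0 sT] : 0 <= s <= T by rewrite in_itv in sT0.
have [aei i1 _ _ _] := Fubini_process (L2proc_L1 La) sT.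
have [_ i2 i3 e _] := Fubini_process (L2proc_Mh La Lh) sT; split => //.
rewrite -e; apply: Rintegral_ae; last 1 first.
- apply: filterS aei => w ai; rewrite RintegralZr//.
- apply: measurable_funM; [exact: integ_measurable i1|exact: Lh.1].
- exact: integ_measurable i2.
Qed.

Lemma Rintegral_expr (s : R) (k : nat) : 0 <= s ->
  mu.-integrable `[0, s] (EFin \o (fun r => r ^+ k)) /\
  \int[mu]_(r in `[0, s]) (r ^+ k) = s ^+ k.+1 / k.+1%:R.
Proof.
move=> s0.
have cX (j : nat) : continuous (fun r : R => r ^+ j) by move=> x; exact: exprn_continuous.
split.
  apply: continuous_compact_integrable; first exact: segment_compact.
  exact: continuous_subspaceT.
have [->|s_neq0] := eqVneq s 0.
  by rewrite set_itv1 Rintegral_set1 expr0n mul0r.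
have {s_neq0}s_gt0 : 0 < s by rewrite lt0r s_neq0.
rewrite /Rintegral (@continuous_FTC2 _ _ (fun x => x ^+ k.+1 / k.+1%:R))//=.
- by rewrite expr0n mul0r subr0.
- exact: continuous_subspaceT.
- split.
  + move=> x _; apply: derivableM; first exact: exprn_derivable.
    exact: derivable_cst.
  + apply: cvg_at_right_filter; apply: cvgM; [exact: cX|exact: cvg_cst].
  + apply: cvg_at_left_filter; apply: cvgM; [exact: cX|exact: cvg_cst].
- move=> x _; rewrite derive1Mr; last exact: exprn_derivable.
  by rewrite exp_derive1 /= -[_ *: _]/(_ * _) mulrAC divff ?mul1r ?pnatr_eq0.
Qed.

Section filtration_measurability.
Variable G : set (set O).
Hypotheses (sG : <<s G >> `<=` measurable) (nG : P.-negligible `<=` <<s G >>).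
Implicit Types f g : O -> R.

(** The pairing of the integral with any h orthogonal to G is the time integral
    of E[a_r h] = 0; this takes the place of an approximation of a by step
    processes. *)
Lemma gmeas_Rintegral a s : L2proc a -> s \in `[0, T] ->
  (forall r, r \in `[0, s] -> gmeas G (a r)) ->
  gmeas G (fun w => \int[mu]_(r in `[0, s]) a r w).
Proof.
move=> La sT ga; apply: (gmeas_of_orth sG nG) => //; first exact: L2_Rintegral.
move=> h Lh oh; have [_ ->] := Rintegral_mulh La Lh sT.
rewrite -[RHS](mul0r (fine (mu `[0, s]%classic))) -Rintegral_cst//.
apply: eq_Rintegral => r; rewrite mem_setE => rs.
have rT := subitv rs sT.
apply: orth_mul (ga _ rs) _ => //; apply: L2M => //; exact: L2proc_L2.
Qed.

(** The test variables orthogonal to G form a module over the bounded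
    G-measurable functions. *)
Lemma orthM (b : O -> R) h (K : R) : gmeas G b -> (forall w, `|b w| <= K) -> L2 P h ->
  orth P G h -> orth P G (fun w => b w * h w).
Proof.
move=> gb bK Lh oh; have mb := gmeas_measurable sG gb.
have ibh := L2_integrable (L2bM mb bK Lh); split => // A GA.
have mA := sG GA.
have g1b : gmeas G (fun w => \1_A w * b w) by apply: gmeasM => //; exact: gmeas_indic.
have b1 w : `|\1_A w * b w| <= K.
  rewrite normrM indicE; apply: le_trans (bK w).
  by case: (w \in A); rewrite ?normr1 ?normr0 ?mul1r ?mul0r.
have i1 := L2_integrable (L2bM (gmeas_measurable sG g1b) b1 Lh).
have := orth_mul sG oh g1b i1.
move=> e; rewrite -[RHS]/((0 : R)%:E) -e EFin_Rintegral//.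
rewrite [LHS]integral_mkcond; apply: eq_integral => w _; rewrite patchE indicE.
by case: ifP => _; rewrite ?mul1r ?mul0r.
Qed.

(** * Adaptedness of the solutions of linear equations *)

Section linear_ode.
Variables (n : nat) (A : 'I_n -> 'I_n -> R -> O -> R) (z g : 'I_n -> R -> O -> R).
Variable t : R.
Hypotheses (tT : t \in `[0, T])
  (bA : forall i j, bproc (A i j)) (Lz : forall i, L2proc (z i))
  (Lg : forall i, L2proc (g i))
  (gA : forall i j r, r \in `[0, t] -> gmeas G (A i j r))
  (gg : forall i r, r \in `[0, t] -> gmeas G (g i r))
  (zE : forall i s, s \in `[0, t] -> {ae P, forall w, z i s w =
     \int[mu]_(r in `[0, s]) (\sum_j A i j r w * z j r w + g i r w)}).

Lemma ode_common_bound : exists K : R, 0 < K /\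
  forall i j r w, r \in `[0, T] -> `|A i j r w| <= K.
Proof.
have /choice[K AK] : forall ij : 'I_n * 'I_n, exists K : R,
    forall r, r \in `[0, T] -> forall w, `|A ij.1 ij.2 r w| <= K.
  by move=> ij; have [_] := bA ij.1 ij.2.
exists (1 + \sum_ij `|K ij|); split; first by rewrite ltr_pwDl// sumr_ge0.
move=> i j r w rT; apply: le_trans (AK (i, j) r rT w) _.
rewrite (bigD1 (i, j))//= addrA addrAC; apply: le_trans (ler_norm _) _.
by rewrite lerDr addr_ge0// sumr_ge0.
Qed.

Lemma ode_common_bound_sqr : exists C : R, 0 <= C /\
  forall i s, s \in `[0, T] -> \int[P]_w (z i s w ^+ 2) <= C.
Proof.
have /choice[K zK] i := L2proc_L2bound (Lz i).
exists (\sum_i `|K i|); split; first exact: sumr_ge0.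
move=> i s sT; apply: le_trans (zK i s sT) _.
by rewrite (bigD1 i)//=; apply: le_trans (ler_norm _) _; rewrite lerDl sumr_ge0.
Qed.

(** Gronwall estimate for the pairings E[z_s h], by induction on the number of
    iterations of the equation. The induction quantifies over all test variables
    because E[A z h] is the pairing of z with the test variable A h; dividing A
    by its bound K keeps the second moment of the test variable below 1. The
    inhomogeneity does not contribute, being measurable. *)
Lemma ode_orth_bound : exists K C : R, forall (k : nat) h,
  L2 P h -> orth P G h -> \int[P]_w (h w ^+ 2) <= 1 ->
  forall s i, s \in `[0, t] ->
  `|\int[P]_w (z i s w * h w)| <= C * exp_coeff (n%:R * K * s) k.
Proof.
have [K [K0 AK]] := ode_common_bound.
have [C [C0 zC]] := ode_common_bound_sqr.
(* |z h| <= z^2 + h^2 gives the bound C + 1 at step zero *)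
exists K, (C + 1) => k.
have tsub s : s \in `[0, t] -> s \in `[0, T] by move=> /subitv; exact.
elim: k => [|k ih] h Lh oh h1 s i st.
  have sT := tsub _ st; have Lzs := L2proc_L2 (Lz i) sT.
  rewrite exp_coeffE /= expr0 mulr1 fact0 invr1 mulr1.
  apply: le_trans (le_normr_Rintegral _ (L2M Lzs Lh)) _ => //.
  apply: (@le_trans _ _ (\int[P]_w (z i s w ^+ 2 + h w ^+ 2))).
    apply: le_Rintegral => //; first exact: integrable_norm (L2M Lzs Lh).
      by apply: integD => //; [exact: Lzs.2|exact: Lh.2].
    move=> w _; rewrite ler_norml.
    have := sqr_ge0 (z i s w + h w); have := sqr_ge0 (z i s w - h w).
    by rewrite sqrrB sqrrD; move=> ? ?; apply/andP; split; nra.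
  by rewrite RintegralD//; [exact: lerD (zC _ _ sT) h1|exact: Lzs.2|exact: Lh.2].
have sT := tsub _ st.
have LAz j : L2proc (fun r w => A i j r w * z j r w) by exact: L2proc_bM.
pose a r w := \sum_j A i j r w * z j r w + g i r w.
have La : L2proc a by apply: L2proc_D => //; exact: L2proc_sum.
have [ia e] := Rintegral_mulh La Lh sT.
have -> : \int[P]_w (z i s w * h w) = \int[mu]_(r in `[0, s]) (\int[P]_w (a r w * h w)).
  rewrite -e; apply: Rintegral_ae.
  - exact: integ_measurable (L2M (L2proc_L2 (Lz i) sT) Lh).
  - exact: integ_measurable (L2M (L2_Rintegral La sT) Lh).
  - by apply: filterS (zE i st) => w ->.
have /andP[s0 sle] : 0 <= s <= t by rewrite in_itv in st.
have ssub r : r \in `[0, s] -> r \in `[0, t] by move=> /subitv; exact.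
have bnd r : r \in `[0, s] -> `|\int[P]_w (a r w * h w)| <=
    n%:R * K * (C + 1) * ((n%:R * K) ^+ k / k`!%:R) * r ^+ k.
  move=> rs; have rt := ssub _ rs; have rT := tsub _ rt.
  have Lgr := L2proc_L2 (Lg i) rT.
  have LAr j := L2proc_L2 (LAz j) rT.
  rewrite /a.
  under eq_Rintegral do rewrite mulrDl mulr_suml.
  rewrite RintegralD//; last 2 first.
  - by apply: integ_sum => // j; exact: L2M.
  - exact: L2M.
  rewrite (orth_mul sG oh (gg i rt) (L2M Lgr Lh)) addr0.
  rewrite Rintegral_sum//; last by move=> j; exact: L2M.
  apply: le_trans (ler_norm_sum _ _ _) _.
  apply: (@le_trans _ _ (\sum_(j < n) K * ((C + 1) * exp_coeff (n%:R * K * r) k))).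
    apply: ler_sum => j _.
    pose b w := K^-1 * A i j r w.
    have gb : gmeas G b by apply: gmeasM; [exact: gmeas_cst|exact: gA].
    have mb := gmeas_measurable sG gb.
    have b1 w : `|b w| <= 1.
      by rewrite normrM gtr0_norm ?invr_gt0// mulrC ler_pdivrMr// mul1r AK.
    have Lbh := L2bM mb b1 Lh.
    have bh1 : \int[P]_w ((b w * h w) ^+ 2) <= 1.
      apply: le_trans h1; apply: le_Rintegral => //; [exact: Lbh.2|exact: Lh.2|].
      move=> w _; rewrite exprMn ler_piMl ?sqr_ge0//.
      by rewrite -(real_normK (num_real (b w))) exprn_ile1.
    have := ih _ Lbh (orthM gb b1 Lh oh) bh1 r j rt.
    move=> /(ler_wpM2l (ltW K0)); apply: le_trans.
    rewrite -{1}(gtr0_norm K0) -normrM -RintegralZl//; last first.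
      by apply: L2M => //; exact: L2proc_L2.
    rewrite le_eqVlt; apply/orP; left; apply/eqP; congr (`| _ |).
    by apply: eq_Rintegral => w _; rewrite /b; field; rewrite gt_eqF.
  rewrite sumr_const card_ord -mulr_natl exp_coeffE /= exprMn.
  by apply/eqP/eqP; rewrite le_eqVlt; apply/orP; left; apply/eqP; field.
have [ir er] := Rintegral_expr k s0.
apply: le_trans (le_normr_Rintegral _ ia) _ => //.
apply: (@le_trans _ _ (\int[mu]_(r in `[0, s])
    (n%:R * K * (C + 1) * ((n%:R * K) ^+ k / k`!%:R) * r ^+ k))).
  apply: le_Rintegral => //; [exact: integrable_norm ia|exact: integZ].
rewrite (RintegralZl _ _ ir)// er exp_coeffE /= factS natrM !exprS.
rewrite (exprMn _ (n%:R * K) s).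
have f0 : k`!%:R != 0 :> R by rewrite pnatr_eq0 -lt0n fact_gt0.
have k0 : k.+1%:R != 0 :> R by rewrite pnatr_eq0.
move: f0 k0; move: (k`!%:R) (k.+1%:R) ((n%:R * K) ^+ k) (s ^+ k) => x y u v x0 y0.
by rewrite le_eqVlt; apply/orP; left; apply/eqP; field; rewrite x0 y0.
Qed.

(** By [ode_orth_bound] the pairings are bounded by every term of a multiple of
    an exponential series, hence vanish. *)
Lemma ode_gmeas i s : s \in `[0, t] -> gmeas G (z i s).
Proof.
move=> st; have [K [C zb]] := ode_orth_bound.
have sT := subitv st tT.
apply: (gmeas_of_orth sG nG); first exact: L2proc_L2.
move=> h Lh oh.
pose v := \int[P]_w (h w ^+ 2).
have v0 : 0 <= v by apply: Rintegral_ge0 => w _; exact: sqr_ge0.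
have v1 : 1 + v != 0 by rewrite gt_eqF// ltr_pwDl.
(* normalization: the second moment of h' is v / (1 + v)^2 <= 1 *)
pose h' w := (1 + v)^-1 * h w.
have Lh' : L2 P h' by exact: L2Z.
have oh' : orth P G h'.
  by apply: (@orthM (cst (1 + v)^-1) h `|(1 + v)^-1|) => //; exact: gmeas_cst.
have h'1 : \int[P]_w (h' w ^+ 2) <= 1.
  under eq_Rintegral do rewrite exprMn.
  rewrite RintegralZl//; last exact: Lh.2.
  rewrite -/v exprVn mulrC ler_pdivrMr ?exprn_gt0// ?ltr_pwDl// mul1r; nra.
have : \int[P]_w (z i s w * h' w) = 0.
  apply/eqP; rewrite -normr_le0.
  have cv : C * exp_coeff (n%:R * K * s) k @[k --> \oo] --> C * 0.
    by apply: cvgM; [exact: cvg_cst|exact: cvg_exp_coeff].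
  rewrite -(mulr0 C) -(cvg_lim _ cv)//.
  apply: limr_ge; first exact: cvgP cv.
  by apply: nearW => k; exact: zb.
under eq_Rintegral do rewrite mulrCA.
rewrite RintegralZl//; last by apply: L2M => //; exact: L2proc_L2.
by move/eqP; rewrite mulf_eq0 invr_eq0 (negbTE v1) => /eqP.
Qed.

End linear_ode.
End filtration_measurability.
End process_integrals.

(** * Joint measurability of the chain *)

Section chain_measurability.
Context {R : realType} {dO : measure_display} {O : measurableType dO}.
Variables (P : probability O R) (T : R) (D : nat) (theta : R -> O -> 'I_D).
Hypotheses (T0 : 0 < T)
  (theta_meas : forall t l, t \in `[0, T] -> measurable [set w | theta t w = l])
  (theta_right : forall w t, 0 <= t < T ->
    exists2 e, 0 < e & forall s, t <= s < t + e -> theta s w = theta t w).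

Local Notation DT := (`[0, T]%classic `*` [set: O] : set (measurableTypeR R * O)).




(** The right end points of the cells of mesh 1 / (k + 1). They are cut off at
    T, so that only times in [0, T] occur and the last point of the interval is
    approximated by itself. *)
Definition grid (k j : nat) : R := Num.min T (j.+1%:R / k.+1%:R).

Definition cell (k j : nat) : set R := `[j%:R / k.+1%:R, j.+1%:R / k.+1%:R[%classic.

Definition chain_approx (l : 'I_D) (k : nat) : set (measurableTypeR R * O) :=
  \bigcup_j ((`[0, T]%classic `&` cell k j) `*` [set w | theta (grid k j) w = l]).

Lemma grid_itv k j : grid k j \in `[0, T].
Proof.
rewrite in_itv /= /grid le_min ltW//= ge_min lexx /=.
by rewrite divr_ge0// ler0n.
Qed.

Lemma measurable_chain_approx l k : measurable (chain_approx l k).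
Proof.
apply: bigcup_measurable => j _; apply: measurableX.
  by apply: measurableI; exact: measurable_itv.
exact: theta_meas (grid_itv k j).
Qed.

Lemma cell_exists k (t : R) : 0 <= t -> exists j, cell k j t.
Proof.
move=> t0; have k0 : 0 < k.+1%:R :> R by rewrite ltr0n.
have tk0 : 0 <= t * k.+1%:R by rewrite mulr_ge0.
exists (Num.truncn (t * k.+1%:R)).
rewrite /cell /= in_itv /= ler_pdivrMr// ltr_pdivlMr//.
exact: truncn_itv.
Qed.

(** The end point of the cell of t tends to t from the right, so the chain
    sampled there is eventually equal to the chain at t by right continuity. *)
Lemma chain_approx_lim w t l : t \in `[0, T] ->
  theta t w = l <-> exists m, forall k, (m <= k)%N -> chain_approx l k (t, w).
Proof.
rewrite in_itv /= => /andP[t0 tT].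
have [m mE] : exists m, forall k j, (m <= k)%N -> cell k j t ->
    theta (grid k j) w = theta t w.
  have [->|tneq] := eqVneq t T.
    exists 0%N => k j _; rewrite /cell /= in_itv /= => /andP[_ Tj].
    by rewrite /grid min_l// ltW.
  have tltT : t < T by rewrite lt_neqAle tneq.
  have [|e e0 te] := @theta_right w t; first by rewrite t0.
  have [m me] : exists m : nat, e^-1 < m.+1%:R.
    have ei : 0 <= e^-1 by rewrite invr_ge0 ltW.
    by exists (Num.truncn e^-1); case/andP: (truncn_itv ei).
  exists m => k j mk; have k0 : 0 < k.+1%:R :> R by rewrite ltr0n.
  rewrite /cell /= in_itv /= => /andP[jt tj]; apply: te.
  rewrite /grid le_min tT ltW//= gt_min; apply/orP; right.
  rewrite -natr1 mulrDl; apply: ler_ltD => //; rewrite mul1r invf_plt ?posrE//.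
  by apply: lt_le_trans me _; rewrite ler_nat.
split=> [tl|[m' app]].
  exists m => k mk; have [j cj] := cell_exists k t0.
  exists j => //; split; first by split=> //=; rewrite in_itv /= t0.
  by rewrite /= (mE k).
have [j _ [[_ cj] /= <-]] := app _ (leq_maxl m' m).
by rewrite (mE _ _ (leq_maxr m' m)).
Qed.

Lemma jmeas_chain l : jmeas T (fun t w => (theta t w == l)%:R).
Proof.
pose S := DT `&` [set z | theta z.1 z.2 = l].
have mS : measurable S.
  rewrite (_ : S = DT `&` \bigcup_m \bigcap_(k in [set k | (m <= k)%N]) chain_approx l k).
    apply: measurableI; first exact: measurable_DT.
    apply: bigcupT_measurable => m; apply: bigcap_measurable; first by exists m => /=.
    by move=> k _; exact: measurable_chain_approx.
  apply/seteqP; split => -[t w] [[/= tT _]] h; split => //.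
    by have [m mk] := (chain_approx_lim w l tT).1 h; exists m.
  by have [m _ mk] := h; apply/(chain_approx_lim w l tT); exists m.
rewrite /jmeas; apply: (eq_measurable_fun (\1_S : measurableTypeR R * O -> R)).
  move=> [t w] /set_mem DTz; rewrite indicE; congr (nat_of_bool _)%:R.
  apply/idP/eqP => [/set_mem[]//|h]; exact/mem_set.
exact/measurable_funTS/measurable_indic.
Qed.

Lemma bproc_chain l : bproc T (fun t w => (theta t w == l)%:R).
Proof.
by split; [exact: jmeas_chain|exists 1 => t _ w; case: eqP; rewrite ?normr1 ?normr0].
Qed.

End chain_measurability.

(** * Square integrable vector processes and conditional expectations *)

Section cond_exp_bridge.
Context {R : realType} {dO : measure_display} {O : measurableType dO}.
Variables (P : probability O R) (T : R).
Hypothesis T0 : 0 <= T.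

Definition vproc {k : nat} (Z : process O R k) : Prop :=
  forall i, L2proc P T (fun t w => Z t w i 0).

Definition vgmeas (G : set (set O)) {k : nat} (f : O -> 'cV[R]_k) : Prop :=
  forall i, gmeas G (fun w => f w i 0).

Lemma vgmeasP G k (f : O -> 'cV[R]_k) : vgmeas G f <-> events_rv f `<=` <<s G >>.
Proof.
split=> [gf A [i [B [mB ->]]]|fG i]; first exact: (gmeasP G _).1.
by apply/gmeasP => B mB; apply: fG; exists i, B.
Qed.

(** The supremum over the times need not be measurable. The integral of a
    nonnegative function is a supremum over the simple functions below it, so it
    is monotone all the same, and bounds the second moments at all times. *)
Lemma vproc_sup {k : nat} (Z : process O R k) :
  measurable_process T Z -> sup_square_integrable P T Z -> vproc Z.
Proof.
move=> mZ sZ i; split; first exact: mZ.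
rewrite /sup_square_integrable in sZ; set S := (\int[P]_w _)%E in sZ.
have S0 : (0 <= S)%E.
  apply: integral_ge0 => w _; apply: ereal_sup_ge; exists (sqnorm (Z 0 w))%:E.
    by exists 0 => //=; rewrite in_itv /= lexx.
  by rewrite lee_fin; apply: sumr_ge0 => a _; apply: sumr_ge0 => b _; exact: sqr_ge0.
have Sfin : S \is a fin_num by rewrite ge0_fin_numE.
exists (fine S) => t tT.
have mt : measurable_fun setT (fun w => Z t w i 0).
  exact: (jmeas_section (mZ i : jmeas T (fun t w => Z t w i 0)) tT).
have le : (\int[P]_w ((Z t w i 0) ^+ 2)%:E <= S)%E.
  have sup_ge w : ((Z t w i 0 ^+ 2)%:E <=
      ereal_sup [set (sqnorm (Z t w))%:E | t in `[0%R, T]])%E.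
    apply: ereal_sup_ge; exists (sqnorm (Z t w))%:E; first by exists t.
    rewrite lee_fin /sqnorm (bigD1 i)//= big_ord1 lerDl.
    by apply: sumr_ge0 => a _; apply: sumr_ge0 => b _; exact: sqr_ge0.
  rewrite /S !ge0_integralTE//; first last.
  - by move=> w; rewrite lee_fin sqr_ge0.
  - by move=> w; apply: le_trans (sup_ge w); rewrite lee_fin sqr_ge0.
  apply: le_ereal_sup => _ [f fZ <-]; exists f => // w.
  exact: le_trans (fZ w) (sup_ge w).
have L : L2 P (fun w => Z t w i 0).
  split => //; apply/integrableP; split; first exact/measurable_EFinP/measurable_funX.
  under eq_integral do rewrite /= ger0_norm ?sqr_ge0//.
  exact: le_lt_trans le sZ.
split => //; rewrite -lee_fin EFin_Rintegral//; last exact: L.2.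
by rewrite fineK.
Qed.

Lemma cond_exp_orth G (Z Z' : O -> R) : <<s G >> `<=` measurable ->
  is_cond_exp P <<s G >> Z Z' -> gmeas G Z' /\ orth P G (fun w => Z w - Z' w).
Proof.
move=> sG [iZ iZ' mZ' eZ]; split; first exact/gmeasP.
split; first exact: integB.
move=> A GA; have mA := sG _ GA.
under eq_integral do rewrite EFinB.
rewrite integralB//; try exact: (integrableS measurableT).
rewrite eZ// subee//; apply: integrable_fin_num => //.
exact: (integrableS measurableT).
Qed.

Lemma cond_process_vproc (E : R -> set (set O)) k (Z Z' : process O R k) :
  (forall t, t \in `[0, T] -> <<s E t >> `<=` measurable) -> vproc Z ->
  is_cond_process P T (fun t => <<s E t >>) Z Z' -> vproc Z'.
Proof.
move=> sE LZ [mZ' cZ] i; split; first exact: mZ'.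
have [K ZK] := L2proc_L2bound (LZ i); exists K => t tT.
have [gZ' oZ] := cond_exp_orth (sE _ tT) (cZ _ i tT).
have [L le] := cond_exp_contraction (sE _ tT) (L2proc_L2 (LZ i) tT) gZ' oZ.
by split => //; exact: le_trans le (ZK _ tT).
Qed.

Lemma cond_processP (F : R -> set (set O)) k (Z : process O R k) :
  has_cond_process P T F Z -> is_cond_process P T F Z (cond_process P T F Z).
Proof. by move=> hZ; exact: (xgetPex _ hZ). Qed.

(** A random variable orthogonal to G and G-measurable is orthogonal to
    itself. *)
Lemma orth_gmeas_ae0 G f : <<s G >> `<=` measurable -> L2 P f ->
  gmeas G f -> orth P G f -> {ae P, forall w, f w = 0}.
Proof.
move=> sG Lf gf oF; apply: L2_eq0 => //; rewrite -(orth_mul sG oF gf (L2M Lf Lf)).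
by apply: eq_Rintegral => w _; rewrite expr2.
Qed.

Lemma orthB G f g : <<s G >> `<=` measurable ->
  orth P G f -> orth P G g -> orth P G (fun w => f w - g w).
Proof.
move=> sG [if_ of_] [ig og]; split; first exact: integB.
move=> A GA; have mA := sG _ GA.
under eq_integral do rewrite EFinB.
rewrite integralB//; try exact: (integrableS measurableT).
by rewrite of_// og// sube0.
Qed.

Lemma cond_exp_ae_unique G (Z Z' Z'' : O -> R) : <<s G >> `<=` measurable ->
  L2 P Z -> is_cond_exp P <<s G >> Z Z' -> is_cond_exp P <<s G >> Z Z'' ->
  {ae P, forall w, Z' w = Z'' w}.
Proof.
move=> sG LZ /(cond_exp_orth sG)[g1 o1] /(cond_exp_orth sG)[g2 o2].
have [L1 _] := cond_exp_contraction sG LZ g1 o1.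
have [L2'' _] := cond_exp_contraction sG LZ g2 o2.
have o := orthB sG o2 o1.
have : {ae P, forall w, Z' w - Z'' w = 0}.
  apply: (@orth_gmeas_ae0 G) => //; [exact: L2B|exact: gmeasB|].
  rewrite (_ : (fun w => _) = (fun w => Z w - Z'' w - (Z w - Z' w)))//.
  by apply/funext => w; ring.
by apply: filterS => w /eqP; rewrite subr_eq0 => /eqP.
Qed.

Lemma cond_process_tower (E F : R -> set (set O)) k (Z Z' Z'' : process O R k) :
  (forall t, t \in `[0, T] -> <<s E t >> `<=` <<s F t >>) ->
  is_cond_process P T (fun t => <<s F t >>) Z Z' ->
  is_cond_process P T (fun t => <<s E t >>) Z Z'' ->
  is_cond_process P T (fun t => <<s E t >>) Z' Z''.
Proof.
move=> EF [_ c1] [m2 c2]; split => // t i tT.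
have [iZ iZ' mZ' eZ'] := c1 t i tT; have [_ iZ'' mZ'' eZ''] := c2 t i tT.
by split => // A EA; rewrite eZ''// eZ'//; exact: EF.
Qed.

End cond_exp_bridge.

(** * Coefficients along the chain *)

Section coefficient_processes.
Context {R : realType} {dO : measure_display} {O : measurableType dO}.
Variables (P : probability O R) (T : R) (D : nat) (theta : R -> O -> 'I_D).
Hypothesis bchain : forall l, bproc T (fun t w => (theta t w == l)%:R : R).

Local Notation mu := (@lebesgue_measure R).

Lemma bproc_sum (I : Type) (s : seq I) (F : I -> R -> O -> R) :
  (forall i, bproc T (F i)) -> bproc T (fun t w => \sum_(i <- s) F i t w).
Proof.
move=> bF; elim: s => [|i s [ms [K sK]]].
  rewrite (_ : (fun t w => _) = (fun _ _ => 0)); first exact: bproc_cst.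
  by apply/funext => t; apply/funext => w; rewrite big_nil.
rewrite (_ : (fun t w => _) = (fun t w => F i t w + \sum_(j <- s) F j t w)).
  have [mi [K' iK]] := bF i; split; first exact: measurable_funD.
  exists (K' + K) => t tT w; apply: le_trans (ler_normD _ _) _.
  by apply: lerD; [exact: iK|exact: sK].
by apply/funext => t; apply/funext => w; rewrite big_cons.
Qed.

Lemma select_sum p k (M : 'I_D -> 'M[R]_(p, k)) l i j :
  M l i j = \sum_l' (l == l')%:R * M l' i j.
Proof.
rewrite (bigD1 l)//= eqxx mul1r big1 ?addr0// => l' ll'.
by rewrite eq_sym (negbTE ll') mul0r.
Qed.

Lemma bproc_coef p k (M : 'I_D -> R -> 'M[R]_(p, k)) i j : bounded_borel T M ->
  bproc T (fun t w => M (theta t w) t i j : R).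
Proof.
move=> [mM [K MK]].
rewrite (_ : (fun t w => _) =
    (fun t w => \sum_l (theta t w == l)%:R * M l t i j)); last first.
  by apply/funext => t; apply/funext => w; rewrite (select_sum (fun l => M l t)).
apply: bproc_sum => l; have [mt [K' tK]] := bchain l; split.
  apply: measurable_funM => //.
  apply: (measurable_comp (measurable_itv `[0, T])) (mM l i j) _; last first.
    by apply: measurable_funTS; exact: measurable_fst.
  by move=> _ [[t w] [/= tT _] <-].
by exists (K' * K) => t tT w; rewrite normrM; apply: ler_pM => //; [exact: tK|exact: MK].
Qed.

Lemma gmeas_coef G t p k (M : 'I_D -> R -> 'M[R]_(p, k)) i j :
  (forall l, <<s G >> [set w | theta t w = l]) ->
  gmeas G (fun w => M (theta t w) t i j).
Proof.
move=> Gt; rewrite (_ : (fun w => _) =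
    (fun w => \sum_l \1_[set w | theta t w = l] w * M l t i j)); last first.
  apply/funext => w; rewrite (select_sum (fun l => M l t)).
  apply: eq_bigr => l _; rewrite indicE; congr ((nat_of_bool _)%:R * _).
  by apply/eqP/idP => [h|/set_mem//]; exact/mem_set.
apply: gmeas_sum => l; apply: gmeasM; last exact: gmeas_cst.
exact: gmeas_indic.
Qed.

Lemma vproc_mulmx p k (M : 'I_D -> R -> 'M[R]_(p, k)) (Z : process O R k) :
  bounded_borel T M -> vproc P T Z ->
  vproc P T (fun t w => M (theta t w) t *m Z t w).
Proof.
move=> bM LZ i.
rewrite (_ : (fun t w => _) =
    (fun t w => \sum_j M (theta t w) t i j * Z t w j 0)); last first.
  by apply/funext => t; apply/funext => w; rewrite mxE.
by apply: L2proc_sum => j; apply: L2proc_bM => //; exact: bproc_coef.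
Qed.

Lemma bproc_L2proc (a : R -> O -> R) : bproc T a -> L2proc P T a.
Proof.
move=> ba; have := L2proc_bM ba (L2proc_cst T (L2_cst P 1)).
rewrite (_ : (fun t w => a t w * 1) = a)//.
by apply/funext => t; apply/funext => w; rewrite mulr1.
Qed.

Lemma vproc_coef k (M : 'I_D -> R -> 'cV[R]_k) :
  bounded_borel T M -> vproc P T (fun t w => M (theta t w) t).
Proof. by move=> bM i; apply: bproc_L2proc; exact: bproc_coef. Qed.

Lemma vprocD k (Z Z' : process O R k) :
  vproc P T Z -> vproc P T Z' -> vproc P T (fun t w => Z t w + Z' t w).
Proof.
move=> LZ LZ' i; rewrite (_ : (fun t w => _) = (fun t w => Z t w i 0 + Z' t w i 0)).
  exact: L2proc_D.
by apply/funext => t; apply/funext => w; rewrite mxE.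
Qed.

Lemma vprocB k (Z Z' : process O R k) :
  vproc P T Z -> vproc P T Z' -> vproc P T (fun t w => Z t w - Z' t w).
Proof.
move=> LZ LZ' i; rewrite (_ : (fun t w => _) = (fun t w => Z t w i 0 - Z' t w i 0)).
  exact: L2proc_B.
by apply/funext => t; apply/funext => w; rewrite !mxE.
Qed.

Lemma vgmeasD G k (f g : O -> 'cV[R]_k) :
  vgmeas G f -> vgmeas G g -> vgmeas G (fun w => f w + g w).
Proof. by move=> gf gg i; under eq_fun do rewrite mxE; exact: gmeasD. Qed.

Lemma vgmeasB G k (f g : O -> 'cV[R]_k) :
  vgmeas G f -> vgmeas G g -> vgmeas G (fun w => f w - g w).
Proof.
by move=> gf gg i; under eq_fun do rewrite mxE [X in _ + X]mxE; exact: gmeasB.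
Qed.

Lemma vgmeas_mulmx G t p k (M : 'I_D -> R -> 'M[R]_(p, k)) (f : O -> 'cV[R]_k) :
  (forall l, <<s G >> [set w | theta t w = l]) -> vgmeas G f ->
  vgmeas G (fun w => M (theta t w) t *m f w).
Proof.
move=> Gt gf i; under eq_fun do rewrite mxE.
by apply: gmeas_sum => j; apply: gmeasM => //; exact: gmeas_coef.
Qed.

Lemma vintB k (f g : process O R k) s : vproc P T f -> vproc P T g ->
  s \in `[0, T] ->
  {ae P, forall w, vint s (f^~ w) - vint s (g^~ w) =
                   vint s (fun r => f r w - g r w)}.
Proof.
move=> Lf Lg; rewrite in_itv /= => /andP[s0 sT].
have ai (h : process O R k) : vproc P T h -> {ae P, forall w, forall i,
    mu.-integrable `[0, s] (EFin \o (fun r => h r w i 0))}.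
  move=> Lh; have hi i := (Fubini_process (L2proc_L1 (Lh i)) sT).
  apply: filter_forall => i; by have [] := hi i.
apply: filterS2 (ai _ Lf) (ai _ Lg) => w fi gi.
apply/colP => i; rewrite !mxE -RintegralB//.
by apply: eq_Rintegral => r _; rewrite !mxE.
Qed.

Lemma vint_gmeas G k (f : process O R k) s : <<s G >> `<=` measurable ->
  P.-negligible `<=` <<s G >> -> vproc P T f -> s \in `[0, T] ->
  (forall r, r \in `[0, s] -> vgmeas G (f r)) ->
  vgmeas G (fun w => vint s (f^~ w)).
Proof.
move=> sG nG Lf sT gf i; under eq_fun do rewrite mxE.
by apply: (gmeas_Rintegral sG nG) => // r rs; exact: gf.
Qed.

End coefficient_processes.

(** * Filtrations and the difference of two states *)

Section control_problem_facts.
Context {R : realType} {dO : measure_display} {O : measurableType dO}.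
Variables (P : probability O R) (T : R).
Context {n m r d D : nat}.
Variables (c : coefficients R n m r d D) (q : weights R n m D)
  (N : noise R O n r d D) (l0 : 'I_D) (mean : 'cV[R]_n) (sigma : 'M[R]_n).
Hypotheses (T0 : 0 < T) (hN : noise_assumptions P T N l0 mean sigma)
  (hA1 : assumption_A1 T c) (hA2 : assumption_A2 T q).

Local Notation theta := (ntheta N).
(* Generators of the filtrations, null sets included: the sigma-algebras they
   generate are convertible with [chain_filtration] and [joint_filtration]. *)
Local Notation chain_gen t := (events_chain theta t `|` P.-negligible).
Local Notation joint_gen Z t :=
  ((events_upto Z t `|` events_chain theta t) `|` P.-negligible).

Let bchain l : bproc T (fun t w => (theta t w == l)%:R : R).
Proof.
apply: bproc_chain => //; first exact: mc_measurable (noise_theta hN).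
exact: mc_right (noise_theta hN).
Qed.

Lemma sigma_algebra_least (E F : set (set O)) : E `<=` <<s F >> -> <<s E >> `<=` <<s F >>.
Proof. by move=> EF; apply: smallest_sub => //; exact: smallest_sigma_algebra. Qed.

Lemma sigma_measurable (E : set (set O)) : E `<=` measurable ->
  <<s E `|` P.-negligible >> `<=` measurable.
Proof.
move=> Em; apply: smallest_sub; first exact: sigma_algebra_measurable.
have [cP _ _] := noise_usual hN.
by move=> A [/Em//|/cP].
Qed.

Lemma sigma_negligible (E : set (set O)) :
  P.-negligible `<=` <<s E `|` P.-negligible >>.
Proof. by move=> A nA; apply: sub_sigma_algebra; right. Qed.

Lemma events_chain_measurable t : t \in `[0, T] ->
  events_chain theta t `<=` measurable.
Proof.
rewrite in_itv /= => /andP[t0 tT] A [s [l [st ->]]].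
apply: (mc_measurable (noise_theta hN)).
by move: st; rewrite !in_itv /= => /andP[-> /le_trans ->].
Qed.

Lemma chain_measurable t : t \in `[0, T] -> <<s chain_gen t >> `<=` measurable.
Proof. by move=> tT; apply: sigma_measurable; exact: events_chain_measurable. Qed.

Lemma joint_measurable k (Z : process O R k) t : measurable_process T Z ->
  t \in `[0, T] -> <<s joint_gen Z t >> `<=` measurable.
Proof.
move=> mZ tT; apply: sigma_measurable => A [[s st [i [B [mB ->]]]]|]; last first.
  exact: events_chain_measurable.
have sT := subitv st tT.
have := jmeas_section (mZ i : jmeas T (fun t w => Z t w i 0)) sT.
by move=> /(_ measurableT _ mB); rewrite setTI.
Qed.

Lemma chain_joint k (Z : process O R k) t :
  <<s chain_gen t >> `<=` <<s joint_gen Z t >>.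
Proof. apply: sigma_algebra_least => A hA; apply: sub_sigma_algebra.
by case: hA => ?; [left; right|right]. Qed.

Lemma joint_mono k (Z : process O R k) s t : s <= t ->
  <<s joint_gen Z s >> `<=` <<s joint_gen Z t >>.
Proof.
move=> st; have sub x : x \in `[0, s] -> x \in `[0, t].
  by rewrite !in_itv /= => /andP[-> /le_trans ->].
apply: sigma_algebra_least => A hA; apply: sub_sigma_algebra.
case: hA => [[[x xs ZA]|[x [l [xs ->]]]]|nA]; last by right.
- by left; left; exists x => //; exact: sub.
- by left; right; exists x, l; split => //; exact: sub.
Qed.

Lemma chain_event G t s l : <<s chain_gen t >> `<=` <<s G >> -> s \in `[0, t] ->
  <<s G >> [set w | theta s w = l].
Proof. by move=> cG st; apply: cG; apply: sub_sigma_algebra; left; exists s, l. Qed.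

Lemma chain_mono s t : s <= t -> <<s chain_gen s >> `<=` <<s chain_gen t >>.
Proof.
move=> st; apply: sigma_algebra_least => A hA; apply: sub_sigma_algebra.
case: hA => [[x [l [xs ->]]]|nA]; last by right.
left; exists x, l; split => //.
by move: xs; rewrite !in_itv /= => /andP[-> /le_trans ->].
Qed.

Lemma adapted_vgmeas k k' (Y : process O R k) (Z : process O R k') t :
  adapted T (joint_filtration P N Y) Z -> t \in `[0, T] ->
  vgmeas (joint_gen Y t) (Z t).
Proof. by move=> aZ tT; apply/vgmeasP; exact: aZ. Qed.

Lemma EthetaP k (Z : process O R k) :
  has_cond_process P T (chain_filtration P N) Z ->
  is_cond_process P T (fun t => <<s chain_gen t >>) Z (Etheta P T N Z).
Proof. exact: cond_processP. Qed.

Lemma Etheta_vproc k (Z : process O R k) : vproc P T Z ->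
  has_cond_process P T (chain_filtration P N) Z -> vproc P T (Etheta P T N Z).
Proof. by move=> LZ /EthetaP; apply: cond_process_vproc => // t; exact: chain_measurable. Qed.

Lemma Etheta_vgmeas k (Z : process O R k) t :
  has_cond_process P T (chain_filtration P N) Z -> t \in `[0, T] ->
  vgmeas (chain_gen t) (Etheta P T N Z t).
Proof.
move=> /EthetaP[_ cZ] tT i.
by have [] := cond_exp_orth (chain_measurable tT) (cZ t i tT).
Qed.

Lemma vgmeas_sub G G' k (f : O -> 'cV[R]_k) :
  <<s G >> `<=` <<s G' >> -> vgmeas G f -> vgmeas G' f.
Proof. by move=> GG' gf i; exact: gmeas_sub (gf i). Qed.

Lemma vgmeas_ae G k (f g : O -> 'cV[R]_k) : P.-negligible `<=` <<s G >> ->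
  {ae P, forall w, f w = g w} -> vgmeas G f -> vgmeas G g.
Proof.
by move=> nG fg gf i; apply: (gmeas_ae nG _ (gf i)); apply: filterS fg => w ->.
Qed.

Lemma subr_cancel (V : zmodType) (x y z : V) : (x + z) - (y + z) = x - y.
Proof. by rewrite opprD addrACA subrr addr0. Qed.

Lemma affine_obs_sub (p k : nat) (M M' : 'M[R]_(p, k)) (x x' y y' : 'cV[R]_k)
    (b : 'cV[R]_p) :
  M *m x + M' *m y + b - (M *m x' + M' *m y' + b) =
  M *m (x - x') + M' *m (y - y').
Proof. by rewrite subr_cancel !mulmxBr opprD addrACA. Qed.

Lemma affine_state_cancel (V : zmodType) (x y z i j : V) :
  (z + x + i + j) - (z + y + i + j) = x - y.
Proof. by rewrite !subr_cancel ![z + _]addrC subr_cancel. Qed.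

Lemma affine_state_sub (p k : nat) (M M' : 'M[R]_(p, k)) (x x' y y' : 'cV[R]_k)
    (g g' b : 'cV[R]_p) :
  M *m x + M' *m y + g + b - (M *m x' + M' *m y' + g' + b) =
  M *m (x - x') + (M' *m (y - y') + (g - g')).
Proof.
by rewrite subr_cancel !mulmxBr opprD addrACA opprD [X in X + _]addrACA -addrA.
Qed.

Section state_difference.
Variables (IW IWb : process O R n) (g1 g2 X1 X2 : process O R n).
Hypotheses (hX1 : linear_sde P T c N IW IWb g1 X1)
  (hX2 : linear_sde P T c N IW IWb g2 X2)
  (Lg1 : vproc P T g1) (Lg2 : vproc P T g2).

Lemma sde_vproc g X : linear_sde P T c N IW IWb g X -> vproc P T X.
Proof. by move=> [mX _ sX _ _]; exact: (vproc_sup (ltW T0)). Qed.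

Lemma sde_diff_eq s : s \in `[0, T] ->
  {ae P, forall w, X1 s w - X2 s w = vint s (fun x =>
     cA c (theta x w) x *m (X1 x w - X2 x w)
     + (cAh c (theta x w) x *m (Etheta P T N X1 x w - Etheta P T N X2 x w)
        + (g1 x w - g2 x w)))}.
Proof.
move=> sT; have [[bA bAh] _ _ _ [bb _]] := hA1.
have [_ _ _ h1 e1] := hX1; have [_ _ _ h2 e2] := hX2.
have L1 := sde_vproc hX1; have L2 := sde_vproc hX2.
have Lint X g : vproc P T X -> has_cond_process P T (chain_filtration P N) X ->
    vproc P T g -> vproc P T (fun x w => cA c (theta x w) x *m X x w
      + cAh c (theta x w) x *m Etheta P T N X x w + g x w + cb c (theta x w) x).
  move=> LX hX Lg; apply: vprocD; last exact: vproc_coef.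
  apply: vprocD => //; apply: vprocD; first exact: vproc_mulmx.
  by apply: vproc_mulmx => //; exact: Etheta_vproc.
apply: filterS3 e1 e2 (vintB (Lint _ _ L1 h1 Lg1) (Lint _ _ L2 h2 Lg2) sT) => w E1 E2 E3.
rewrite (E1 _ sT) (E2 _ sT); apply: etrans (affine_state_cancel _ _ _ _ _) _.
apply: (etrans E3); congr vint; apply/funext => x; exact: affine_state_sub.
Qed.

(** The stochastic integrals cancel in [sde_diff_eq], and the conditional means
    given the chain are known from the chain, so the difference solves a linear
    equation with G-measurable data. *)
Lemma sde_diff_vgmeas G t : t \in `[0, T] -> <<s G >> `<=` measurable ->
  P.-negligible `<=` <<s G >> -> <<s chain_gen t >> `<=` <<s G >> ->
  (forall s, s \in `[0, t] -> vgmeas G (fun w => g1 s w - g2 s w)) ->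
  forall s, s \in `[0, t] -> vgmeas G (fun w => X1 s w - X2 s w).
Proof.
move=> tT sG nG cG gg s st i.
have [[bA bAh] _ _ _ [bb _]] := hA1.
have [_ _ _ h1 _] := hX1; have [_ _ _ h2 _] := hX2.
have L1 := sde_vproc hX1; have L2 := sde_vproc hX2.
pose z (i : 'I_n) (x : R) w := (X1 x w - X2 x w) i 0.
pose g (i : 'I_n) (x : R) w :=
  (cAh c (theta x w) x *m (Etheta P T N X1 x w - Etheta P T N X2 x w)
        + (g1 x w - g2 x w)) i 0.
pose A (i j : 'I_n) (x : R) w := cA c (theta x w) x i j.
apply: (@ode_gmeas _ _ _ P T G sG nG n A z g t tT _ _ _ _ _ _ i s st).
- by move=> a b; exact: bproc_coef.
- exact: vprocB.
- apply: vprocD; last exact: vprocB.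
  by apply: vproc_mulmx => //; apply: vprocB; exact: Etheta_vproc.
- by move=> a b x xt; apply: gmeas_coef => l; exact: chain_event cG xt.
- move=> a x xt; have xT := subitv xt tT.
  have cxG : <<s chain_gen x >> `<=` <<s G >>.
    apply: subset_trans cG; apply: chain_mono.
    by move: xt; rewrite in_itv /= => /andP[].
  apply: (vgmeasD _ (gg _ xt)).
  apply: vgmeas_mulmx; first by move=> l; exact: chain_event cG xt.
  by apply: vgmeasB; apply: (vgmeas_sub cxG); exact: Etheta_vgmeas.
- move=> a x xt; apply: filterS (sde_diff_eq (subitv xt tT)) => w.
  rewrite /z => ->; rewrite mxE; apply: eq_Rintegral => y _.
  by rewrite mxE [X in X + _]mxE.
Qed.

End state_difference.

(** * The observation and the control generate the same information *)

Section observation_difference.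
Variables (Z1 Z2 : process O R n) (Y1 Y2 : process O R r).
Hypotheses (hY1 : is_observation P T c N Z1 Y1) (hY2 : is_observation P T c N Z2 Y2)
  (L1 : vproc P T Z1) (L2 : vproc P T Z2)
  (h1 : has_cond_process P T (chain_filtration P N) Z1)
  (h2 : has_cond_process P T (chain_filtration P N) Z2).

Lemma obs_diff_eq s : s \in `[0, T] ->
  {ae P, forall w, Y1 s w - Y2 s w = vint s (fun x =>
     cF c (theta x w) x *m (Z1 x w - Z2 x w)
     + cFh c (theta x w) x *m (Etheta P T N Z1 x w - Etheta P T N Z2 x w))}.
Proof.
move=> sT; have [_ _ _ [bF bFh] [_ bf]] := hA1.
have [_ _ e1] := hY1; have [_ _ e2] := hY2.
have Lint Z : vproc P T Z -> has_cond_process P T (chain_filtration P N) Z ->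
    vproc P T (fun x w => cF c (theta x w) x *m Z x w
      + cFh c (theta x w) x *m Etheta P T N Z x w + cf c (theta x w) x).
  move=> LZ hZ; apply: vprocD; last exact: vproc_coef.
  apply: vprocD; first exact: vproc_mulmx.
  by apply: vproc_mulmx => //; exact: Etheta_vproc.
apply: filterS3 e1 e2 (vintB (Lint _ L1 h1) (Lint _ L2 h2) sT) => w E1 E2 E3.
rewrite (E1 _ sT) (E2 _ sT); apply: etrans (subr_cancel _ _ _) _.
apply: (etrans E3); congr vint; apply/funext => x; exact: affine_obs_sub.
Qed.

Lemma obs_diff_vgmeas G t : t \in `[0, T] -> <<s G >> `<=` measurable ->
  P.-negligible `<=` <<s G >> -> <<s chain_gen t >> `<=` <<s G >> ->
  (forall s, s \in `[0, t] -> vgmeas G (fun w => Z1 s w - Z2 s w)) ->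
  forall s, s \in `[0, t] -> vgmeas G (fun w => Y1 s w - Y2 s w).
Proof.
move=> tT sG nG cG gZ s st; have sT := subitv st tT.
have [_ _ _ [bF bFh] _] := hA1.
pose f x w := cF c (theta x w) x *m (Z1 x w - Z2 x w)
  + cFh c (theta x w) x *m (Etheta P T N Z1 x w - Etheta P T N Z2 x w).
apply: (@vgmeas_ae _ _ (fun w => vint s (f^~ w)) _ nG).
  by apply: filterS (obs_diff_eq sT) => w ->.
apply: (vint_gmeas sG nG _ sT).
  apply: vprocD; apply: vproc_mulmx => //; first exact: vprocB.
  by apply: vprocB; exact: Etheta_vproc.
move=> x xs; have xt : x \in `[0, t] by exact: subitv xs st.
have xT := subitv xt tT.
have cxG : <<s chain_gen x >> `<=` <<s G >>.
  apply: subset_trans cG; apply: chain_mono.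
  by move: xt; rewrite in_itv /= => /andP[].
have Gx l : <<s G >> [set w | theta x w = l] by exact: chain_event cG xt.
apply: vgmeasD; apply: vgmeas_mulmx => //; first exact: gZ.
by apply: vgmeasB; apply: (vgmeas_sub cxG); exact: Etheta_vgmeas.
Qed.

End observation_difference.

(** Y1 is recovered from Y2 by adding a correction that Y2 determines. *)
Lemma joint_sub k (Y1 Y2 : process O R k) t :
  (forall s, s \in `[0, t] -> vgmeas (joint_gen Y2 t) (fun w => Y1 s w - Y2 s w)) ->
  <<s joint_gen Y1 t >> `<=` <<s joint_gen Y2 t >>.
Proof.
move=> gd; apply: sigma_algebra_least => A [[[s st ZA]|cA]|nA].
- suff : vgmeas (joint_gen Y2 t) (Y1 s) by move=> /vgmeasP; exact.
  rewrite (_ : Y1 s = fun w => (Y1 s w - Y2 s w) + Y2 s w); last first.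
    by apply/funext => w; rewrite subrK.
  apply: vgmeasD; first exact: gd.
  apply/vgmeasP => B YB; apply: sub_sigma_algebra; left; left.
  by exists s.
- by apply: sub_sigma_algebra; left; right.
- by apply: sub_sigma_algebra; right.
Qed.

Section admissible.
Variables (IW IWb : process O R n) (eta : process O R n) (lambda : process O R r)
  (X : process O R m -> process O R n) (Y : process O R m -> process O R r)
  (XF : process O R m -> process O R n).
Hypotheses (heta : is_uncontrolled_state P T c N IW IWb eta)
  (hlambda : is_observation P T c N eta lambda)
  (hX : forall v, controls P T N lambda v -> is_state P T c N IW IWb v (X v))
  (hY : forall v, controls P T N lambda v -> is_observation P T c N (X v) (Y v))
  (hXF : forall v, admissible_controls P T N lambda Y v ->
             is_filter P T N (X v) (Y v) (XF v)).
Local Notation Uad := (admissible_controls P T N lambda Y).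

Implicit Types u v : process O R m.

Lemma control_vproc v : controls P T N lambda v -> vproc P T v.
Proof. by move=> [mv _ sv]; exact: (vproc_sup (ltW T0)). Qed.

Lemma state_vproc v : controls P T N lambda v -> vproc P T (X v).
Proof. by move=> /hX[_ /sde_vproc]. Qed.

Lemma state_has_cond v : controls P T N lambda v ->
  has_cond_process P T (chain_filtration P N) (X v).
Proof. by move=> /hX[_ []]. Qed.

Lemma vproc0 k : vproc P T (fun (_ : R) (_ : O) => (0 : 'cV[R]_k)).
Proof.
move=> i; under eq_fun do under eq_fun do rewrite mxE.
exact: L2proc_cst (L2_cst P 0).
Qed.

Lemma state_diff_vgmeas k (Y' : process O R k) v t : measurable_process T Y' ->
  controls P T N lambda v -> adapted T (joint_filtration P N Y') v ->
  t \in `[0, T] -> forall s, s \in `[0, t] ->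
  vgmeas (joint_gen Y' t) (fun w => X v s w - eta s w).
Proof.
move=> mY' cv av tT; have [hv sX] := hX cv; have Lv := control_vproc cv.
have [_ [bB bBh] _ _ _] := hA1.
apply: (sde_diff_vgmeas sX heta) => //.
- apply: vprocD; first exact: vproc_mulmx.
  by apply: vproc_mulmx => //; exact: Etheta_vproc.
- exact: vproc0.
- exact: joint_measurable.
- exact: sigma_negligible.
- exact: chain_joint.
- move=> s st; have sT := subitv st tT.
  have le_st : s <= t by move: st; rewrite in_itv /= => /andP[].
  have Gs l : <<s joint_gen Y' t >> [set w | theta s w = l].
    by apply: (chain_event l _ st); exact: chain_joint.
  under eq_fun do rewrite subr0.
  apply: vgmeasD; apply: vgmeas_mulmx => //.
    apply: (vgmeas_sub (joint_mono le_st)); exact: adapted_vgmeas av sT.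
  apply: (vgmeas_sub (@chain_joint _ Y' t)).
  by apply: (vgmeas_sub (chain_mono le_st)); exact: Etheta_vgmeas.
Qed.

(** An admissible control is adapted to both observations, so both determine
    X^v - eta and therefore Y^v - lambda; [joint_sub] applies in both
    directions. *)
Lemma joint_filtration_eq v t : Uad v -> t \in `[0, T] ->
  <<s joint_gen (Y v) t >> = <<s joint_gen lambda t >>.
Proof.
move=> [cv av] tT; have [mY _ _] := hY cv; have [ml _ _] := hlambda.
have [_ al _] := cv.
have [_ _ _ heta' _] := heta.
have Leta := sde_vproc heta.
have LX := state_vproc cv; have hXc := state_has_cond cv.
apply/seteqP; split; apply: joint_sub.
  apply: (obs_diff_vgmeas (hY cv) hlambda) => //.
  - exact: joint_measurable.
  - exact: sigma_negligible.
  - exact: chain_joint.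
  - exact: state_diff_vgmeas.
apply: (obs_diff_vgmeas hlambda (hY cv)) => //.
- exact: joint_measurable.
- exact: sigma_negligible.
- exact: chain_joint.
- move=> s st; have gd := state_diff_vgmeas mY cv av tT st.
  rewrite (_ : (fun w => _) = (fun w => 0 - (X v s w - eta s w))); last first.
    by apply/funext => w; rewrite sub0r opprB.
  by apply: vgmeasB => // i; under eq_fun do rewrite mxE; exact: gmeas_cst.
Qed.

(** The difference of the two errors is orthogonal to the common observation
    sigma-algebra, as a difference of errors, and measurable for it, because
    X^u - X^v = (X^u - eta) - (X^v - eta) is; so it vanishes. *)
Lemma filter_error_indep u v t : Uad u -> Uad v -> t \in `[0, T] ->
  {ae P, forall w, X u t w - XF u t w = X v t w - XF v t w}.
Proof.
move=> Uu Uv tT; have [cu au] := Uu; have [cv av] := Uv.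
have [ml _ _] := hlambda.
have sG : <<s joint_gen lambda t >> `<=` measurable by exact: joint_measurable.
have tt : t \in `[0, t] by move: tT; rewrite !in_itv /= lexx => /andP[->].
have Ftr v' : Uad v' -> forall i, gmeas (joint_gen lambda t) (fun w => XF v' t w i 0) /\
    orth P (joint_gen lambda t) (fun w => X v' t w i 0 - XF v' t w i 0).
  move=> Uv' i; apply: cond_exp_orth => //; rewrite -(joint_filtration_eq Uv' tT).
  by have [_] := hXF Uv'; exact.
have FL v' : Uad v' -> forall i, L2 P (fun w => XF v' t w i 0).
  move=> Uv' i; have [g o] := Ftr _ Uv' i.
  by have [] := cond_exp_contraction sG (L2proc_L2 (state_vproc Uv'.1 i) tT) g o.
have Xg v' : Uad v' -> vgmeas (joint_gen lambda t) (fun w => X v' t w - eta t w).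
  by move=> [[ma aa sa] _]; apply: state_diff_vgmeas.
have key i : {ae P, forall w, (X u t w i 0 - XF u t w i 0)
     - (X v t w i 0 - XF v t w i 0) = 0}.
  have [gu ou] := Ftr _ Uu i; have [gv ov] := Ftr _ Uv i.
  have Lu := L2proc_L2 (state_vproc cu i) tT; have Lv := L2proc_L2 (state_vproc cv i) tT.
  apply: (orth_gmeas_ae0 sG); [|
    |exact: orthB].
    by apply: L2B; apply: L2B => //; exact: FL.
  have := gmeasB (gmeasB (Xg _ Uu i) (Xg _ Uv i)) (gmeasB gu gv).
  congr gmeas; apply/funext => w; rewrite !mxE; ring.
have : {ae P, forall w, forall i, (X u t w i 0 - XF u t w i 0)
     - (X v t w i 0 - XF v t w i 0) = 0} by exact: filter_forall.
apply: filterS => w h; apply/colP => i; rewrite !mxE.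
by apply/eqP; rewrite -subr_eq0; apply/eqP; exact: h.
Qed.

(** * Quadratic costs *)

(** The terms of the running cost; a terminal weight is the case of a constant
    family of matrices. *)
Definition coef_form p k (M : 'I_D -> R -> 'M[R]_(p, k)) (a : process O R p)
    (b : process O R k) (t : R) (w : O) : R :=
  inner (a t w) (M (theta t w) t *m b t w).

Lemma coef_form_L1proc p k (M : 'I_D -> R -> 'M[R]_(p, k)) (a : process O R p)
    (b : process O R k) :
  bounded_borel T M -> vproc P T a -> vproc P T b -> L1proc P T (coef_form M a b).
Proof.
move=> bM La Lb; apply: L1proc_sum => i; apply: L2proc_M => //.
exact: (vproc_mulmx bchain bM Lb).
Qed.

Lemma L1proc_Z (k : R) (a : R -> O -> R) :
  L1proc P T a -> L1proc P T (fun t w => k * a t w).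
Proof.
move=> [ma [K aK]]; split; first exact: measurable_funM.
exists (`|k| * K) => t tT; have [ia iaK] := aK _ tT; split; first exact: integZ.
under eq_Rintegral do rewrite normrM.
rewrite RintegralZl//; first by rewrite ler_wpM2l.
exact: integrable_norm ia.
Qed.

(** The entries of A multiplied by those of f are square integrable and
    G-measurable, hence orthogonal to the entries of e. *)
Lemma Rintegral_inner_orth G p k (A : O -> 'M[R]_(p, k)) (f : O -> 'cV[R]_p)
    (e : O -> 'cV[R]_k) (K : R) : <<s G >> `<=` measurable ->
  (forall i j, gmeas G (fun w => A w i j)) -> (forall w i j, `|A w i j| <= K) ->
  vgmeas G f -> (forall i, L2 P (fun w => f w i 0)) ->
  (forall j, L2 P (fun w => e w j 0)) ->
  (forall j, orth P G (fun w => e w j 0)) ->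
  \int[P]_w (inner (f w) (A w *m e w)) = 0.
Proof.
move=> sG gA AK gf Lf Le oe.
have LAf i j : L2 P (fun w => A w i j * f w i 0).
  by apply: (@L2bM _ _ _ _ _ K) => //; exact: gmeas_measurable (gA i j).
under eq_Rintegral => w _.
  rewrite /inner; under eq_bigr => i _ do rewrite mxE mulr_sumr.
  over.
rewrite Rintegral_sum//; last first.
  move=> i; apply: integ_sum => // j.
  by under eq_fun do rewrite mulrCA mulrA; exact: L2M.
rewrite big1// => i _; rewrite Rintegral_sum//; last first.
  by move=> j; under eq_fun do rewrite mulrCA mulrA; exact: L2M.
rewrite big1// => j _; under eq_Rintegral do rewrite mulrCA mulrA.
apply: (orth_mul sG (oe j)); last exact: L2M.
by apply: gmeasM => //; exact: gf.
Qed.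

Lemma innerC k (x y : 'cV[R]_k) : inner x y = inner y x.
Proof. by apply: eq_bigr => i _; rewrite mulrC. Qed.

Lemma innerDl k (x y z : 'cV[R]_k) : inner (x + y) z = inner x z + inner y z.
Proof. by rewrite -big_split; apply: eq_bigr => i _; rewrite mxE mulrDl. Qed.

Lemma innerDr k (x y z : 'cV[R]_k) : inner z (x + y) = inner z x + inner z y.
Proof. by rewrite !(innerC z) innerDl. Qed.

Lemma inner_trmx p k (M : 'M[R]_(p, k)) (x : 'cV[R]_p) (y : 'cV[R]_k) :
  inner x (M *m y) = inner y (M^T *m x).
Proof.
rewrite /inner; under eq_bigr do rewrite mxE mulr_sumr.
under [RHS]eq_bigr do rewrite mxE mulr_sumr.
rewrite exchange_big; apply: eq_bigr => j _; apply: eq_bigr => i _.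
by rewrite mxE; ring.
Qed.

Lemma bounded_borel_tr p k (M : 'I_D -> R -> 'M[R]_(p, k)) :
  bounded_borel T M -> bounded_borel T (fun l t => (M l t)^T).
Proof.
move=> [mM [K MK]]; split; last by exists K => l t i j tT; rewrite mxE; exact: MK.
move=> l i j; rewrite (_ : (fun t => _) = (fun t => M l t j i))//.
by apply/funext => t; rewrite mxE.
Qed.

Lemma Rintegral_coef_form_orth G t p k (M : 'I_D -> R -> 'M[R]_(p, k))
    (a : process O R p) (b : process O R k) : t \in `[0, T] ->
  <<s G >> `<=` measurable -> <<s chain_gen t >> `<=` <<s G >> ->
  bounded_borel T M -> vproc P T a -> vproc P T b -> vgmeas G (a t) ->
  (forall j, orth P G (fun w => b t w j 0)) -> \int[P]_w (coef_form M a b t w) = 0.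
Proof.
move=> tT sG cG [mM [K MK]] La Lb ga ob.
have tt : t \in `[0, t] by move: tT; rewrite !in_itv /= lexx => /andP[->].
apply: (@Rintegral_inner_orth G p k (fun w => M (theta t w) t) (a t) (b t) K) => //.
- by move=> i j; apply: gmeas_coef => l; exact: chain_event cG tt.
- by move=> w i j; exact: MK.
- by move=> i; exact: L2proc_L2 (La i) tT.
- by move=> i; exact: L2proc_L2 (Lb i) tT.
Qed.

(** Expansion around f; the last group collects the terms linear in x - f, whose
    mean is zero when f is the filter of x. The transpose comes from moving M
    from f to x - f. *)
Lemma quadratic_expand p k (M : 'M[R]_k) (M' : 'M[R]_(p, k)) (u : 'cV[R]_p)
    (x f : 'cV[R]_k) :
  inner x (M *m x) + 2 * inner u (M' *m x) =
  inner f (M *m f) + 2 * inner u (M' *m f) + inner (x - f) (M *m (x - f))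
  + (inner f (M *m (x - f)) + inner f (M^T *m (x - f)) + 2 * inner u (M' *m (x - f))).
Proof.
have -> : x = f + (x - f) by rewrite addrC subrK.
set e := x - f; rewrite -[f + e - f]addrAC subrr add0r -(inner_trmx M e f).
rewrite !mulmxDr !innerDl !innerDr; ring.
Qed.

Lemma bounded_borel_cst p k (M : 'I_D -> 'M[R]_(p, k)) :
  bounded_borel T (fun l (_ : R) => M l).
Proof.
split; first by move=> l i j; exact: measurable_cst.
exists (\sum_l \sum_i \sum_j `|M l i j|) => l t i j _.
rewrite (bigD1 l)//= (bigD1 i)//= (bigD1 j)//= -!addrA lerDl.
by rewrite !addr_ge0// ?sumr_ge0// => *; rewrite ?sumr_ge0// => *; rewrite sumr_ge0.
Qed.

Section cost_of_process.
Variables (Z : process O R n) (v : process O R m).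
Hypotheses (LZ : vproc P T Z) (Lv : vproc P T v)
  (hZ : has_cond_process P T (chain_filtration P N) Z)
  (hv : has_cond_process P T (chain_filtration P N) v).

Lemma running_cost_L1proc : L1proc P T (running_cost P T q N Z v).
Proof.
have [[bH bHh] [bG bGh] [bR bRh] _ _] := hA2.
have LEZ := Etheta_vproc LZ hZ; have LEv := Etheta_vproc Lv hv.
apply: L1proc_D; last exact: (coef_form_L1proc bRh LEv LEv).
apply: L1proc_D; last exact/L1proc_Z/(coef_form_L1proc bGh LEv LEZ).
apply: L1proc_D; last exact: (coef_form_L1proc bHh LEZ LEZ).
apply: L1proc_D; last exact: (coef_form_L1proc bR Lv Lv).
apply: L1proc_D; last exact/L1proc_Z/(coef_form_L1proc bG Lv LZ).
exact: (coef_form_L1proc bH LZ LZ).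
Qed.

Lemma T_in_itv : T \in `[0, T].
Proof. by rewrite in_itv /= lexx ltW. Qed.

Lemma terminal_cost_integrable :
  P.-integrable setT (EFin \o terminal_cost P T q N Z).
Proof.
have LEZ := Etheta_vproc LZ hZ.
apply: integD => //.
  exact: L1proc_integrable (coef_form_L1proc (bounded_borel_cst (wS q)) LZ LZ) T_in_itv.
exact: L1proc_integrable (coef_form_L1proc (bounded_borel_cst (wSh q)) LEZ LEZ) T_in_itv.
Qed.

Lemma costE : cost P T q N Z v =
  (2^-1 * (\int[@lebesgue_measure R]_(t in `[0, T]) (\int[P]_w running_cost P T q N Z v t w)
           + \int[P]_w terminal_cost P T q N Z w))%:E.
Proof.
have L := running_cost_L1proc; have it := terminal_cost_integrable.
have [ai i1 _ e mi] := Fubini_process L (lexx T).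
rewrite /cost EFinM; congr (_ * _)%E.
rewrite -e -RintegralD// EFin_Rintegral//; last exact: integD.
apply: ae_eq_integral => //.
- apply: emeasurable_funD; last exact: measurable_int it.
  exact: mi.
- by apply: measurable_int (integD measurableT i1 it).
- by apply: filterS ai => w iw _ /=; rewrite [RHS]EFinD [in RHS]EFin_Rintegral.
Qed.

End cost_of_process.

Lemma Rintegral_decomp (f f1 f2 f3 : O -> R) :
  P.-integrable setT (EFin \o f) -> P.-integrable setT (EFin \o f1) ->
  P.-integrable setT (EFin \o f2) -> P.-integrable setT (EFin \o f3) ->
  \int[P]_w f3 w = 0 -> {ae P, forall w, f w = f1 w + f2 w + f3 w} ->
  \int[P]_w f w = \int[P]_w f1 w + \int[P]_w f2 w.
Proof.
move=> i0 i1 i2 i3 e3 fE; have i12 := integD measurableT i1 i2.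
rewrite -[RHS]addr0 -e3 -RintegralD// -RintegralD//.
apply: Rintegral_ae fE; first exact: integ_measurable i0.
exact: integ_measurable (integD measurableT i12 i3).
Qed.

(** * Splitting the cost into filter and estimation error *)

Section filtered_cost.
Variable v : process O R m.
Hypothesis Uv : Uad v.

Let cv : controls P T N lambda v := Uv.1.
Let LX : vproc P T (X v) := state_vproc cv.
Let Lv : vproc P T v := control_vproc cv.
Let hXv : has_cond_process P T (chain_filtration P N) (X v) := state_has_cond cv.
Let hv : has_cond_process P T (chain_filtration P N) v := (hX cv).1.

Definition filter_error : process O R n := fun t w => X v t w - XF v t w.
Local Notation err := filter_error.

Let sGY t : t \in `[0, T] -> <<s joint_gen (Y v) t >> `<=` measurable.
Proof. by have [mY _ _] := hY cv; exact: joint_measurable. Qed.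

Let LXF : vproc P T (XF v).
Proof. exact: (cond_process_vproc (E := fun t => joint_gen (Y v) t) sGY LX (hXF Uv)). Qed.

(** Tower property: the chain is observed, so the filter has the same
    conditional mean given the chain as the state. *)
Lemma filter_Etheta :
  is_cond_process P T (fun t => <<s chain_gen t >>) (XF v) (Etheta P T N (X v)).
Proof.
have := EthetaP hXv; apply: (cond_process_tower (F := fun t => joint_gen (Y v) t)).
  by move=> t _; exact: chain_joint.
exact: hXF Uv.
Qed.

Let hXFv : has_cond_process P T (chain_filtration P N) (XF v).
Proof. by exists (Etheta P T N (X v)); exact: filter_Etheta. Qed.

Lemma Etheta_filter t : t \in `[0, T] ->
  {ae P, forall w, Etheta P T N (X v) t w = Etheta P T N (XF v) t w}.
Proof.
move=> tT; have [_ c1] := filter_Etheta; have [_ c2] := EthetaP hXFv.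
have : {ae P, forall w, forall i,
    Etheta P T N (X v) t w i 0 = Etheta P T N (XF v) t w i 0}.
  apply: filter_forall => i.
  by apply: (cond_exp_ae_unique (chain_measurable tT) _ (c1 t i tT) (c2 t i tT));
    exact: L2proc_L2 (LXF i) tT.
by apply: filterS => w h; apply/colP.
Qed.

Let Lerr : vproc P T err.
Proof. exact: vprocB. Qed.

Let err_orth t j : t \in `[0, T] ->
  orth P (joint_gen (Y v) t) (fun w => err t w j 0).
Proof.
move=> tT; have [_ cF] := hXF Uv; have [_ o] := cond_exp_orth (sGY tT) (cF t j tT).
rewrite (_ : (fun w => _) = (fun w => X v t w j 0 - XF v t w j 0))//.
by apply/funext => w; rewrite !mxE.
Qed.

Let XF_vgmeas t : t \in `[0, T] -> vgmeas (joint_gen (Y v) t) (XF v t).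
Proof.
by move=> tT i; have [_ cF] := hXF Uv; have [] := cond_exp_orth (sGY tT) (cF t i tT).
Qed.

Lemma Rintegral_running_cost t : t \in `[0, T] ->
  \int[P]_w running_cost P T q N (X v) v t w =
  \int[P]_w running_cost P T q N (XF v) v t w + \int[P]_w coef_form (wH q) err err t w.
Proof.
move=> tT; have [[bH bHh] [bG bGh] [bR bRh] _ _] := hA2.
have iF := L1proc_integrable (running_cost_L1proc LXF Lv hXFv hv) tT.
have iX := L1proc_integrable (running_cost_L1proc LX Lv hXv hv) tT.
have iee := L1proc_integrable (coef_form_L1proc bH Lerr Lerr) tT.
have bHt := bounded_borel_tr bH.
have i1 := L1proc_integrable (coef_form_L1proc bH LXF Lerr) tT.
have i2 := L1proc_integrable (coef_form_L1proc bHt LXF Lerr) tT.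
have i3 := L1proc_integrable (coef_form_L1proc bG Lv Lerr) tT.
have i3' := integZ measurableT 2 i3.
pose cross w := coef_form (wH q) (XF v) err t w
  + coef_form (fun l t => (wH q l t)^T) (XF v) err t w + 2 * coef_form (wG q) v err t w.
have icross : P.-integrable setT (EFin \o cross).
  by apply: integD => //; exact: integD.
have cross0 : \int[P]_w cross w = 0.
  have orth0 p (M : 'I_D -> R -> 'M[R]_(p, n)) (a : process O R p) :
      bounded_borel T M -> vproc P T a -> vgmeas (joint_gen (Y v) t) (a t) ->
      \int[P]_w (coef_form M a err t w) = 0.
    move=> bM La ga; apply: (Rintegral_coef_form_orth tT (sGY tT)) => //.
      exact: chain_joint.
    by move=> j; exact: err_orth.
  rewrite RintegralD//; last exact: integD.
  rewrite RintegralD// RintegralZl// !orth0//.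
  - by rewrite mulr0 !addr0.
  - exact: adapted_vgmeas Uv.2 tT.
  - exact: XF_vgmeas.
  - exact: XF_vgmeas.
apply: (Rintegral_decomp iX iF iee icross cross0).
apply: filterS (Etheta_filter tT) => w Ew.
rewrite /running_cost /cross /coef_form Ew /filter_error.
rewrite (quadratic_expand _ _ (v t w) (X v t w) (XF v t w)); ring.
Qed.

Lemma Rintegral_terminal_cost :
  \int[P]_w terminal_cost P T q N (X v) w =
  \int[P]_w terminal_cost P T q N (XF v) w
  + \int[P]_w coef_form (fun l _ => wS q l) err err T w.
Proof.
have bS := bounded_borel_cst (wS q); have bSt := bounded_borel_tr bS.
have iF := terminal_cost_integrable LXF hXFv.
have iX := terminal_cost_integrable LX hXv.
have iee := L1proc_integrable (coef_form_L1proc bS Lerr Lerr) T_in_itv.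
have i1 := L1proc_integrable (coef_form_L1proc bS LXF Lerr) T_in_itv.
have i2 := L1proc_integrable (coef_form_L1proc bSt LXF Lerr) T_in_itv.
pose cross w := coef_form (fun l _ => wS q l) (XF v) err T w
  + coef_form (fun l _ => (wS q l)^T) (XF v) err T w.
have icross : P.-integrable setT (EFin \o cross) by exact: integD.
have cross0 : \int[P]_w cross w = 0.
  have orth0 p (M : 'I_D -> R -> 'M[R]_(p, n)) (a : process O R p) :
      bounded_borel T M -> vproc P T a -> vgmeas (joint_gen (Y v) T) (a T) ->
      \int[P]_w (coef_form M a err T w) = 0.
    move=> bM La ga; apply: (Rintegral_coef_form_orth T_in_itv (sGY T_in_itv)) => //.
      exact: chain_joint.
    by move=> j; apply: err_orth; exact: T_in_itv.
  rewrite RintegralD// !orth0//; first by rewrite addr0.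
  - by apply: XF_vgmeas; exact: T_in_itv.
  - by apply: XF_vgmeas; exact: T_in_itv.
apply: (Rintegral_decomp iX iF iee icross cross0).
apply: filterS (Etheta_filter T_in_itv) => w Ew.
rewrite /terminal_cost /cross /coef_form Ew /filter_error.
have := quadratic_expand (wS q (theta T w)) (0 : 'M[R]_n) 0 (X v T w) (XF v T w).
rewrite !mul0mx; set z := inner 0 0.
have -> : z = 0 by rewrite /z /inner big1// => i _; rewrite mxE mul0r.
rewrite !mulr0 !addr0 => ->; ring.
Qed.

Definition estimation_cost : R :=
  2^-1 * (\int[@lebesgue_measure R]_(t in `[0, T]) (\int[P]_w coef_form (wH q) err err t w)
          + \int[P]_w coef_form (fun l _ => wS q l) err err T w).

(** The running costs are split at each fixed time and then integrated, since
    conditional expectations are only defined up to a null set depending on the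
    time. *)
Lemma cost_filter :
  cost P T q N (X v) v = (cost P T q N (XF v) v + estimation_cost%:E)%E.
Proof.
have [[bH _] _ _ _ _] := hA2.
have [_ _ iF _ _] := Fubini_process (running_cost_L1proc LXF Lv hXFv hv) (lexx T).
have [_ _ ie _ _] := Fubini_process (coef_form_L1proc bH Lerr Lerr) (lexx T).
rewrite !costE// -EFinD; congr EFin; rewrite /estimation_cost -mulrDr; congr (_ * _).
rewrite Rintegral_terminal_cost addrACA; congr (_ + _); rewrite -RintegralD//.
by apply: eq_Rintegral => t; rewrite mem_setE => tT; exact: Rintegral_running_cost.
Qed.

End filtered_cost.

Lemma estimation_cost_indep u v : Uad u -> Uad v ->
  estimation_cost u = estimation_cost v.
Proof.
move=> Uu Uv; have [[bH _] _ _ _ _] := hA2.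
have Le u' : Uad u' -> vproc P T (filter_error u').
  move=> Uu'; apply: vprocB; first exact: state_vproc Uu'.1.
  apply: (cond_process_vproc (E := fun t => joint_gen (Y u') t) _
    (state_vproc Uu'.1) (hXF Uu')).
  by have [mY _ _] := hY Uu'.1; move=> t; exact: joint_measurable.
have key t (M : 'I_D -> R -> 'M[R]_n) : t \in `[0, T] -> bounded_borel T M ->
    \int[P]_w coef_form M (filter_error u) (filter_error u) t w =
    \int[P]_w coef_form M (filter_error v) (filter_error v) t w.
  move=> tT bM; apply: Rintegral_ae.
  - exact: integ_measurable (L1proc_integrable (coef_form_L1proc bM (Le _ Uu) (Le _ Uu)) tT).
  - exact: integ_measurable (L1proc_integrable (coef_form_L1proc bM (Le _ Uv) (Le _ Uv)) tT).
  - by apply: filterS (filter_error_indep Uu Uv tT) => w e; rewrite /coef_form /filter_error e.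
have eT := key T _ T_in_itv (bounded_borel_cst (wS q)).
have eH : \int[@lebesgue_measure R]_(t in `[0, T])
      (\int[P]_w coef_form (wH q) (filter_error u) (filter_error u) t w) =
    \int[@lebesgue_measure R]_(t in `[0, T])
      (\int[P]_w coef_form (wH q) (filter_error v) (filter_error v) t w).
  by apply: eq_Rintegral => t; rewrite mem_setE => tT; exact: (key t _ tT bH).
exact: (f_equal2 (fun x y => 2^-1 * (x + y)) eH eT).
Qed.

End admissible.
End control_problem_facts.

(** * Equivalence of the two problems *)

Lemma ereal_inf_attainedP {R : realType} {V : Type} (S : set V) (f : V -> \bar R) u :
  S u -> f u = ereal_inf [set f v | v in S] <-> forall v, S v -> (f u <= f v)%E.
Proof.
move=> Su; split=> [-> v Sv|fmin]; first by apply: ereal_inf_lbound; exists v.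
apply/eqP; rewrite eq_le; apply/andP; split.
  by apply: le_ereal_inf_tmp => _ [v Sv <-]; exact: fmin.
by apply: ereal_inf_lbound; exists u.
Qed.
Lemma ereal_inf_attained_shift {R : realType} {V : Type} (S : set V)
    (f g : V -> \bar R) (k : R) u :
  (forall v, S v -> f v = (g v + k%:E)%E) -> S u ->
  f u = ereal_inf [set f v | v in S] <-> g u = ereal_inf [set g v | v in S].
Proof.
move=> fg Su; rewrite !ereal_inf_attainedP//.
by split=> h v Sv; move: (h v Sv); rewrite !fg// leeD2rE.
Qed.

Theorem theorem3p2 (R : realType) (dO : measure_display) (O : measurableType dO)
    (P : probability O R) (T : R) (n m r d D : nat)
    (hT : 0 < T) (hn : (0 < n)%N) (hm : (0 < m)%N) (hr : (0 < r)%N)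
    (hd : (0 < d)%N) (hD : (0 < D)%N)
    (c : coefficients R n m r d D) (q : weights R n m D)
    (N : noise R O n r d D)
    (l0 : 'I_D) (mean : 'cV[R]_n) (sigma : 'M[R]_n)
    (hN : noise_assumptions P T N l0 mean sigma)
    (hA1 : assumption_A1 T c) (hA2 : assumption_A2 T q)
    (hA3 : assumption_A3 T q)
    (IW IWb : process O R n)
    (hIW : is_ito_integral P T (full_filtration P N) (nW N)
             (fun t w => cC c (ntheta N t w) t) IW)
    (hIWb : is_ito_integral P T (full_filtration P N) (nWb N)
             (fun t w => cCb c (ntheta N t w) t) IWb)
    (eta : process O R n) (lambda : process O R r)
    (heta : is_uncontrolled_state P T c N IW IWb eta)
    (hlambda : is_observation P T c N eta lambda)
    (X : process O R m -> process O R n) (Y : process O R m -> process O R r)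
    (hX : forall v, controls P T N lambda v -> is_state P T c N IW IWb v (X v))
    (hY : forall v, controls P T N lambda v ->
            is_observation P T c N (X v) (Y v))
    (XF : process O R m -> process O R n)
    (hXF : forall v, admissible_controls P T N lambda Y v ->
             is_filter P T N (X v) (Y v) (XF v)) :
  let Uad := admissible_controls P T N lambda Y in
  let JP := fun v => cost P T q N (X v) v in
  let JF := fun v => cost P T q N (XF v) v in
  forall u, Uad u ->
    (JP u = ereal_inf [set JP v | v in Uad] <->
     JF u = ereal_inf [set JF v | v in Uad]).
Proof.
move=> Uad JP JF u Uu.
pose k := estimation_cost P T q N X XF u.
have JPE v : Uad v -> JP v = (JF v + k%:E)%E.
  move=> Uv; apply: (etrans (cost_filter hT hN hA2 hX hY hXF Uv)).
  by rewrite /k (estimation_cost_indep hT hN hA1 hA2 heta hlambda hX hY hXF Uu Uv).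
exact: (ereal_inf_attained_shift JPE Uu).
Qed.
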